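(* There is a (nonuniform) lattice $\Gamma$ of $SO_0(1,2)$ for which ${\mathcal T}^+=\{0\}$ in $H^1(\Gamma,{\mathbb R}^{1,2})$.
   Context: Let ${\bf M}^n$ be ${\mathbb R}^n$ with $\langle\cdot|\cdot\rangle=-dx_0^2+dx_1^2+\dots+dx_{n-1}^2$ (here $n=3$), future being $x_0$ increasing, $N$ the standard Euclidean norm, and ${\mathbb R}^{1,n-1}$ the underlying linear space with its $SO_0(1,n-1)$-action. ${\rm Isom}({\bf M}^n)$ is the group of affine transformations with linear part in $SO_0(1,n-1)$. Let ${\mathcal J}$ be the set of lightlike (degenerate) affine hyperplanes, identified with ${\mathcal S}^+\times{\mathbb R}$, where ${\mathcal S}^+$ is the set of future-oriented lightlike vectors $v$ with $N(v)=1$, via $(v,s)\leftrightarrow\{p:\langle v|p\rangle=s\}$. For $\Lambda\subset{\mathcal J}$ set $\Omega^+(\Lambda)=\{p\in{\bf M}^n:\langle v|p\rangle<s\ \forall(v,s)\in\Lambda\}$. A future complete regular convex domain is a nonempty set $\Omega^+(\Lambda)$ with $\Lambda\subset{\mathcal J}$ closed and containing at least two elements. Let $\Gamma$ be a nonelementary discrete subgroup of $SO_0(1,n-1)$ (nonelementary: all orbits in $\overline{\mathbb H}^{n-1}$ are infinite). A morphism $\rho:\Gamma\to{\rm Isom}({\bf M}^n)$ whose linear part is the identity has the form $\rho(\gamma)x=\gamma x+\tau(\gamma)$ with $\tau\in Z^1(\Gamma,{\mathbb R}^{1,n-1})$, i.e. $\tau(\gamma\gamma')=\tau(\gamma)+\gamma\tau(\gamma')$.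 Coboundaries are $\tau(\gamma)=\gamma v-v$, and they correspond to conjugation by translations, so such representations up to conjugacy by translations are parametrized by $H^1(\Gamma,{\mathbb R}^{1,n-1})=Z^1/B^1$. ${\mathcal T}^+\subset H^1(\Gamma,{\mathbb R}^{1,n-1})$ is the set of classes $[\tau]$ whose associated representation $\rho$ is such that $\rho(\Gamma)$ preserves some future complete regular convex domain. *)

(* Defs.v *)
From HB Require Import structures.
From mathcomp Require Import all_boot all_order all_algebra.
From mathcomp Require Import all_classical all_reals all_analysis.
Set Implicit Arguments.
Unset Strict Implicit.
Unset Printing Implicit Defensive.
Import Order.TTheory GRing.Theory Num.Theory.
Import numFieldNormedType.Exports.
Local Open Scope classical_set_scope.
Local Open Scope ring_scope.

(* The Minkowski space M^{d+1} and its underlying linear space R^{1,d} are both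
   'cV[R]_d.+1; the coordinate of index ord0 is the time coordinate x_0. *)
Definition mink (R : realType) (d : nat) (x y : 'cV[R]_d.+1) : R :=
  - (x ord0 0 * y ord0 0) + \sum_(i < d) x (lift ord0 i) 0 * y (lift ord0 i) 0.

Definition enorm (R : realType) (d : nat) (x : 'cV[R]_d.+1) : R :=
  Num.sqrt (\sum_(i < d.+1) x i 0 ^+ 2).

Definition SO1 (R : realType) (d : nat) : set 'M[R]_d.+1 :=
  [set A | (forall x y : 'cV[R]_d.+1, mink (A *m x) (A *m y) = mink x y) /\
           \det A = 1].

Definition SO1_0 (R : realType) (d : nat) : set 'M[R]_d.+1 :=
  connected_component (@SO1 R d) 1%:M.

(* Groups of matrices are sets of matrices, with the topology induced by
   'M[R]_d.+1. *)
Definition is_subgroup (R : realType) (d : nat) (G Gam : set 'M[R]_d.+1) : Prop :=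
  [/\ Gam `<=` G, Gam 1%:M,
      (forall A B, Gam A -> Gam B -> Gam (A *m B)) &
      (forall A, Gam A -> A \in unitmx /\ Gam (invmx A))].

Definition is_discrete_subgroup (R : realType) (d : nat)
    (G Gam : set 'M[R]_d.+1) : Prop :=
  is_subgroup G Gam /\ Gam `<=` isolated Gam.

Definition borelM (R : realType) (d : nat) :=
  g_sigma_algebraType (@open 'M[R]_d.+1).

(* A left Haar measure on the closed matrix group G, seen as a Borel measure on
   the ambient space 'M[R]_d.+1 that is carried by G; Borel regularity is
   automatic there. *)
Definition is_haar (R : realType) (d : nat) (G : set 'M[R]_d.+1)
    (mu : {measure set (borelM R d) -> \bar R}) : Prop :=
  [/\ mu (~` G) = 0%E,
      (0 < mu G)%E,
      (forall K : set 'M[R]_d.+1, compact K -> (mu K < +oo)%E) &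
      (forall (g : 'M[R]_d.+1) (A : set (borelM R d)), G g -> measurable A ->
         mu ((fun x : 'M[R]_d.+1 => g *m x) @` A) = mu A)].

(* F is a Borel subset of G that meets every coset g Gam in exactly one point. *)
Definition strict_fundamental_domain (R : realType) (d : nat)
    (G Gam : set 'M[R]_d.+1) (F : set (borelM R d)) : Prop :=
  [/\ measurable F, F `<=` G &
      forall g : 'M[R]_d.+1, G g ->
        exists! x : 'M[R]_d.+1, F x /\ exists2 h, Gam h & x = g *m h].

(* Discrete of finite covolume; since Haar measures are proportional, the
   choice of mu is irrelevant. *)
Definition is_lattice (R : realType) (d : nat) (G Gam : set 'M[R]_d.+1) : Prop :=
  is_discrete_subgroup G Gam /\
  exists (mu : {measure set (borelM R d) -> \bar R}) (F : set (borelM R d)),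
    [/\ is_haar G mu, strict_fundamental_domain G Gam F & (mu F < +oo)%E].

(* Compactness of G / Gam for the quotient topology: the open subsets of G / Gam
   correspond to the right Gam-invariant relatively open subsets of G, that is
   to the traces on G of the open sets O below. *)
Definition is_uniform (R : realType) (d : nat) (G Gam : set 'M[R]_d.+1) : Prop :=
  forall (I : choiceType) (D : set I) (O : I -> set 'M[R]_d.+1),
    (forall i, D i -> open (O i) /\
       (forall g h, G g -> O i g -> Gam h -> O i (g *m h))) ->
    G `<=` cover D O -> finite_subset_cover D O G.

(* The compactification of the hyperbolic space, in the projective model: a ray
   of future causal vectors is represented by its vector of Euclidean norm 1. *)
Definition hbar (R : realType) (d : nat) : set 'cV[R]_d.+1 :=
  [set v | [/\ mink v v <= 0, 0 < v ord0 0 & enorm v = 1]].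

Definition hact (R : realType) (d : nat) (A : 'M[R]_d.+1) (v : 'cV[R]_d.+1) :
    'cV[R]_d.+1 :=
  (enorm (A *m v))^-1 *: (A *m v).

Definition nonelementary (R : realType) (d : nat) (Gam : set 'M[R]_d.+1) : Prop :=
  forall v, hbar v -> ~ finite_set ((fun A => hact A v) @` Gam).

Definition Splus (R : realType) (d : nat) : set 'cV[R]_d.+1 :=
  [set v | [/\ mink v v = 0, 0 < v ord0 0 & enorm v = 1]].

Definition lightlike_hyperplanes (R : realType) (d : nat) :
    set ('cV[R]_d.+1 * R) :=
  [set vs | Splus vs.1].

Definition Omega_plus (R : realType) (d : nat) (L : set ('cV[R]_d.+1 * R)) :
    set 'cV[R]_d.+1 :=
  [set p | forall vs, L vs -> mink vs.1 p < vs.2].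

(* The set of lightlike hyperplanes is closed in the ambient product, so being
   closed in either of them is the same. *)
Definition regular_domain (R : realType) (d : nat) (Om : set 'cV[R]_d.+1) : Prop :=
  exists L : set ('cV[R]_d.+1 * R),
    [/\ L `<=` @lightlike_hyperplanes R d,
        closed L,
        (exists a b, [/\ L a, L b & a <> b]),
        Om = Omega_plus L &
        Om !=set0].

(* Cochains are total functions on matrices of which only the values on Gam
   matter: all conditions below, including cohomologous, are restricted to Gam. *)
Definition Z1 (R : realType) (d : nat) (Gam : set 'M[R]_d.+1) :
    set ('M[R]_d.+1 -> 'cV[R]_d.+1) :=
  [set tau | forall A B, Gam A -> Gam B -> tau (A *m B) = tau A + A *m tau B].

Definition cohomologous (R : realType) (d : nat) (Gam : set 'M[R]_d.+1)
    (tau tau' : 'M[R]_d.+1 -> 'cV[R]_d.+1) : Prop :=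
  exists v : 'cV[R]_d.+1, forall A, Gam A -> tau' A - tau A = A *m v - v.

(* The class of tau in H^1 = Z^1 / B^1, as the coset tau + B^1. *)
Definition H1class (R : realType) (d : nat) (Gam : set 'M[R]_d.+1)
    (tau : 'M[R]_d.+1 -> 'cV[R]_d.+1) : set ('M[R]_d.+1 -> 'cV[R]_d.+1) :=
  [set tau' | Z1 Gam tau' /\ cohomologous Gam tau tau'].

Definition affine_rep (R : realType) (d : nat)
    (tau : 'M[R]_d.+1 -> 'cV[R]_d.+1) (A : 'M[R]_d.+1) (x : 'cV[R]_d.+1) :
    'cV[R]_d.+1 :=
  A *m x + tau A.

Definition Tplus (R : realType) (d : nat) (Gam : set 'M[R]_d.+1) :
    set (set ('M[R]_d.+1 -> 'cV[R]_d.+1)) :=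
  [set c | exists tau, [/\ Z1 Gam tau, c = H1class Gam tau &
     exists Om, regular_domain Om /\
       forall A, Gam A -> affine_rep tau A @` Om = Om]].

(* Main.v *)
(* R^{1,2} is identified with the symmetric 2x2 matrices, (x0, x1, x2) being
   [[x0 + x1, x2], [x2, x0 - x1]], on which SL_2(R) acts by X |-> g X g^T; this maps
   SL_2(R) onto SO_0(1,2).  The lattice is the (2,4,oo) triangle group, generated by
   the rotation of order 4 about the time axis and a parabolic element T.

   Haar measure is the cone measure: A |-> Leb {m : 0 < det m <= 1, [m] in A}, whose
   invariance is that of Lebesgue measure under shears.  A fundamental domain is
   obtained by minimizing a proper linear height on each orbit (ties are broken
   lexicographically); reduction theory puts it in a Siegel set of finite measure.

   If an affine action with cocycle tau preserves a regular domain, choose a null vector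
   w for which <w|.> is bounded above on the domain.  Along the orbit of a point under
   the powers T^n, n in Z, <w|.> is a polynomial in n of degree at most 3 (at most 1 if
   w is the direction v fixed by T), and in that degree its coefficient is a nonzero
   multiple of <v|tau(T)>; so <v|tau(T)> = 0.  As the group is a triangle group, the
   relations then make tau a coboundary. *)
Require Import Defs.
From HB Require Import structures.
From mathcomp Require Import all_boot all_order all_algebra.
From mathcomp Require Import all_classical all_reals all_analysis.
From mathcomp Require Import measurable_realfun.
From mathcomp Require Import ring lra.
Set Implicit Arguments.
Unset Strict Implicit.
Unset Printing Implicit Defensive.
Import Order.TTheory GRing.Theory Num.Theory.
Import numFieldNormedType.Exports.
Local Open Scope classical_set_scope.
Local Open Scope ring_scope.

(** * Coordinates in dimension three and the Lorentz form *)

Local Notation o0 := (@Ordinal 3 0 isT).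
Local Notation o1 := (@Ordinal 3 1 isT).
Local Notation o2 := (@Ordinal 3 2 isT).

Lemma ord3P (P : 'I_3 -> Prop) : P o0 -> P o1 -> P o2 -> forall i, P i.
Proof.
move=> P0 P1 P2 [[|[|[|//]]] Hi].
- by rewrite (_ : Ordinal Hi = o0) //; apply: val_inj.
- by rewrite (_ : Ordinal Hi = o1) //; apply: val_inj.
- by rewrite (_ : Ordinal Hi = o2) //; apply: val_inj.
Qed.

Lemma sum_ord3 (V : nmodType) (F : 'I_3 -> V) : \sum_i F i = F o0 + F o1 + F o2.
Proof.
rewrite !big_ord_recl big_ord0 addr0 addrA.
by congr (F _ + F _ + F _); apply: val_inj.
Qed.

Section Matrices3.
Context {R : comNzRingType}.

Definition mx3 (a b c d e f g h k : R) : 'M[R]_3 :=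
  \matrix_(i, j) nth 0 (nth [::] [:: [:: a; b; c]; [:: d; e; f]; [:: g; h; k]] i) j.

Definition cv3 (a b c : R) : 'cV[R]_3 := \col_i nth 0 [:: a; b; c] i.

Lemma matrix3P (A B : 'M[R]_3) :
  A o0 o0 = B o0 o0 -> A o0 o1 = B o0 o1 -> A o0 o2 = B o0 o2 ->
  A o1 o0 = B o1 o0 -> A o1 o1 = B o1 o1 -> A o1 o2 = B o1 o2 ->
  A o2 o0 = B o2 o0 -> A o2 o1 = B o2 o1 -> A o2 o2 = B o2 o2 -> A = B.
Proof. by move=> *; apply/matrixP; apply: ord3P; apply: ord3P. Qed.

Lemma colvec3P (x y : 'cV[R]_3) :
  x o0 0 = y o0 0 -> x o1 0 = y o1 0 -> x o2 0 = y o2 0 -> x = y.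
Proof. by move=> *; apply/colP; apply: ord3P. Qed.

Lemma mulmx3E n p (A : 'M[R]_(n, 3)) (B : 'M[R]_(3, p)) i j :
  (A *m B) i j = A i o0 * B o0 j + A i o1 * B o1 j + A i o2 * B o2 j.
Proof. by rewrite mxE sum_ord3. Qed.

Lemma det3E (A : 'M[R]_3) : \det A =
  A o0 o0 * (A o1 o1 * A o2 o2 - A o1 o2 * A o2 o1)
  - A o0 o1 * (A o1 o0 * A o2 o2 - A o1 o2 * A o2 o0)
  + A o0 o2 * (A o1 o0 * A o2 o1 - A o1 o1 * A o2 o0).
Proof.
have det2 (M : 'M[R]_2) : \det M = M 0 0 * M 1 1 - M 0 1 * M 1 0.
  rewrite (expand_det_row _ 0) big_ord_recl big_ord1 /cofactor !det_mx11 !mxE /=.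
  have -> : lift (0 : 'I_2) (0 : 'I_1) = 1 by apply: val_inj.
  have -> : lift (1 : 'I_2) (0 : 'I_1) = 0 by apply: val_inj.
  by rewrite /= add0n expr0 expr1; ring.
rewrite (expand_det_row _ o0) sum_ord3 /cofactor !det2 !mxE.
rewrite /= !add0n expr0 expr1 expr2.
have e1 : lift o0 (0 : 'I_2) = o1 by apply: val_inj.
have e2 : lift o0 (1 : 'I_2) = o2 by apply: val_inj.
have e3 : lift o1 (0 : 'I_2) = o0 by apply: val_inj.
have e4 : lift o1 (1 : 'I_2) = o2 by apply: val_inj.
have e5 : lift o2 (0 : 'I_2) = o0 by apply: val_inj.
have e6 : lift o2 (1 : 'I_2) = o1 by apply: val_inj.
by rewrite e1 e2 e3 e4 e5 e6; ring.
Qed.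

Lemma mx3_eta (A : 'M[R]_3) :
  A = mx3 (A o0 o0) (A o0 o1) (A o0 o2) (A o1 o0) (A o1 o1) (A o1 o2)
          (A o2 o0) (A o2 o1) (A o2 o2).
Proof. by apply: matrix3P; rewrite mxE. Qed.

End Matrices3.

Definition Jmx {R : comNzRingType} : 'M[R]_3 := mx3 (-1) 0 0 0 1 0 0 0 1.

Section Lorentz.
Context {R : realType}.
Implicit Types (A B : 'M[R]_3) (x y : 'cV[R]_3).

Lemma mink3E x y :
  mink x y = - (x o0 0 * y o0 0) + x o1 0 * y o1 0 + x o2 0 * y o2 0.
Proof.
rewrite /mink !big_ord_recl big_ord0 addr0 addrA.
by congr (- (x _ _ * y _ _) + x _ _ * y _ _ + x _ _ * y _ _); apply: val_inj.
Qed.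

Lemma enorm3E x : enorm x = Num.sqrt (x o0 0 ^+ 2 + x o1 0 ^+ 2 + x o2 0 ^+ 2).
Proof. by rewrite /enorm sum_ord3. Qed.

Lemma mink_trmx x y : mink x y = (x^T *m Jmx *m y) 0 0.
Proof. by rewrite mink3E !mulmx3E !mxE /=; ring. Qed.

Lemma SO1E A : SO1 A <-> A^T *m Jmx *m A = Jmx /\ \det A = 1.
Proof.
split=> -[H D]; split=> //.
  apply/matrixP => i j.
  have E (M : 'M[R]_3) :
      ((delta_mx i 0 : 'cV[R]_3)^T *m M *m (delta_mx j 0 : 'cV[R]_3)) 0 0 = M i j.
    by rewrite trmx_delta -rowE -colE !mxE.
  have := H (delta_mx i 0) (delta_mx j 0).
  by rewrite !mink_trmx E trmx_mul => <-; rewrite -[in LHS]E !mulmxA.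
move=> x y; rewrite !mink_trmx trmx_mul.
by rewrite -[in RHS]H !mulmxA.
Qed.

End Lorentz.

(** * The spin parametrization *)

Section Spin.
Context {R : realType}.
Implicit Types (a b c d s t : R) (A B : 'M[R]_3).

(* X |-> g X g^T / det g for g = [[a, b], [c, d]]; it is 0 when det g = 0. *)
Definition spin a b c d : 'M[R]_3 :=
  (a * d - b * c)^-1 *: mx3
    ((a^+2 + b^+2 + c^+2 + d^+2) / 2) ((a^+2 - b^+2 + c^+2 - d^+2) / 2) (a * b + c * d)
    ((a^+2 + b^+2 - c^+2 - d^+2) / 2) ((a^+2 - b^+2 - c^+2 + d^+2) / 2) (a * b - c * d)
    (a * c + b * d) (a * c - b * d) (a * d + b * c).

Lemma spinM a b c d a' b' c' d' :
  spin a b c d *m spin a' b' c' d' =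
  spin (a * a' + b * c') (a * b' + b * d') (c * a' + d * c') (c * b' + d * d').
Proof.
rewrite /spin -scalemxAl -scalemxAr scalerA -invfM.
rewrite (_ : (a * d - b * c) * (a' * d' - b' * c') =
  (a * a' + b * c') * (c * b' + d * d') - (a * b' + b * d') * (c * a' + d * c')); last by ring.
by congr (_ *: _); apply: matrix3P; rewrite !mulmx3E !mxE /=; field.
Qed.

Lemma spin1 : spin 1 0 0 1 = 1%:M.
Proof. by apply: matrix3P; rewrite !mxE /=; field. Qed.

Lemma spinZ (t a b c d : R) : t != 0 -> spin (t * a) (t * b) (t * c) (t * d) = spin a b c d.
Proof.
move=> t0; rewrite /spin (_ : t * a * (t * d) - t * b * (t * c) = t ^+ 2 * (a * d - b * c)); last by ring.
rewrite invfM mulrC -scalerA; congr (_ *: _).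
by apply: matrix3P; rewrite !mxE /=; field.
Qed.

Lemma spin_cast a b c d a' b' c' d' : a = a' -> b = b' -> c = c' -> d = d' ->
  spin a b c d = spin a' b' c' d'.
Proof. by move=> -> -> -> ->. Qed.

(** A matrix times its adjugate is the scalar matrix of its determinant, and by [spinZ] scalars do
    not change [spin]. *)
Lemma spinV a b c d : a * d - b * c != 0 ->
  spin a b c d *m spin d (- b) (- c) a = 1%:M.
Proof.
move=> D; rewrite spinM -spin1 -(spinZ 1 0 0 1 D).
by apply: spin_cast; ring.
Qed.

Lemma spinVl a b c d : a * d - b * c != 0 ->
  spin d (- b) (- c) a *m spin a b c d = 1%:M.
Proof. by move=> D; apply: mulmx1C; exact: spinV. Qed.

Lemma spin_SO1 a b c d : a * d - b * c != 0 -> SO1 (spin a b c d).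
Proof.
move=> D; apply/SO1E; split; last by rewrite det3E !mxE /=; field.
by apply: matrix3P; rewrite !mulmx3E !mxE /=; field.
Qed.

Lemma SO1_mul A B : SO1 A -> SO1 B -> SO1 (A *m B).
Proof.
move=> [HA dA] [HB dB]; split; last by rewrite det_mulmx dA dB mulr1.
by move=> x y; rewrite -!mulmxA HA HB.
Qed.

(** [Jmx *m A^T *m Jmx] is a left inverse of [A], hence a right inverse; relations between columns
    thus become relations between rows. *)
Lemma SO1_trmx A : SO1 A -> A *m Jmx *m A^T = Jmx.
Proof.
move=> /SO1E[H _].
have JJ : (Jmx : 'M[R]_3) *m Jmx = 1%:M.
  by apply: matrix3P; rewrite !mulmx3E !mxE /=; ring.
have K : (Jmx *m A^T *m Jmx) *m A = 1%:M by rewrite -2!mulmxA (mulmxA A^T) H JJ.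
have := mulmx1C K => K2.
by rewrite -[LHS]mulmx1 -JJ !mulmxA -(mulmxA A) -(mulmxA A) K2 mul1mx.
Qed.

Lemma SO1_row A : SO1 A ->
  [/\ A o0 o0 ^+ 2 - A o0 o1 ^+ 2 - A o0 o2 ^+ 2 = 1,
      A o1 o1 ^+ 2 + A o1 o2 ^+ 2 = 1 + A o1 o0 ^+ 2 &
      A o2 o1 ^+ 2 + A o2 o2 ^+ 2 = 1 + A o2 o0 ^+ 2].
Proof.
move=> /SO1_trmx H; split.
- by move/matrixP/(_ o0 o0): H; rewrite !mulmx3E !mxE /=; nra.
- by move/matrixP/(_ o1 o1): H; rewrite !mulmx3E !mxE /=; nra.
- by move/matrixP/(_ o2 o2): H; rewrite !mulmx3E !mxE /=; nra.
Qed.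

Lemma SO1_col A : SO1 A ->
  [/\ A o0 o0 ^+ 2 - A o1 o0 ^+ 2 - A o2 o0 ^+ 2 = 1,
      A o1 o1 ^+ 2 + A o2 o1 ^+ 2 = 1 + A o0 o1 ^+ 2 &
      A o1 o2 ^+ 2 + A o2 o2 ^+ 2 = 1 + A o0 o2 ^+ 2].
Proof.
move=> /SO1E[H _]; split.
- by move/matrixP/(_ o0 o0): H; rewrite !mulmx3E !mxE /=; nra.
- by move/matrixP/(_ o1 o1): H; rewrite !mulmx3E !mxE /=; nra.
- by move/matrixP/(_ o2 o2): H; rewrite !mulmx3E !mxE /=; nra.
Qed.

(* A is a rotation about the time axis, the image of the half-angle rotation. *)
Lemma SO1_fix_spin A : SO1 A -> A o0 o0 = 1 -> A o1 o0 = 0 -> A o2 o0 = 0 ->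
  exists a b c d, 0 < a * d - b * c /\ A = spin a b c d.
Proof.
move=> S A00 A10 A20.
have [r0 r1 r2] := SO1_row S; have [_ c1 c2] := SO1_col S.
have /SO1E[_ D] := S.
rewrite det3E in D.
have [A01 A02] : A o0 o1 = 0 /\ A o0 o2 = 0.
  have h1 := sqr_ge0 (A o0 o1); have h2 := sqr_ge0 (A o0 o2).
  by rewrite A00 in r0; split; apply/eqP; rewrite -sqrf_eq0; apply/eqP; lra.
rewrite A00 A01 A02 A10 A20 in D r1 r2 c1 c2.
set c := A o1 o1 in D r1 r2 c1 c2; set s := A o2 o1 in D r1 r2 c1 c2.
set u := A o1 o2 in D r1 r2 c1 c2; set v := A o2 o2 in D r1 r2 c1 c2.
(* For a block with rows of norm 1 this sum of squares is 2 - 2 det: an orthogonal 2x2 block of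
   determinant 1 is a rotation. *)
have vc : v = c.
  have : (v - c) ^+ 2 + (u + s) ^+ 2 = 0 by nra.
  have := sqr_ge0 (u + s) => h1; have := sqr_ge0 (v - c) => h2 h.
  by apply/eqP; rewrite -subr_eq0 -sqrf_eq0; apply/eqP; lra.
have us : u = - s.
  have : (v - c) ^+ 2 + (u + s) ^+ 2 = 0 by nra.
  have := sqr_ge0 (u + s) => h1; have := sqr_ge0 (v - c) => h2 h.
  by apply/eqP; rewrite -addr_eq0 -sqrf_eq0; apply/eqP; lra.
have cs : c ^+ 2 + s ^+ 2 = 1 by lra.
have Aeq : A = mx3 1 0 0 0 c (- s) 0 s c.
  by rewrite [LHS]mx3_eta A00 A01 A02 A10 A20 -/c -/s -/u -/v vc us.
(* The half-angle matrix [[1 + c, - s], [s, 1 + c]] has determinant 2 (1 + c), so the half-turn is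
   treated apart. *)
have [c1N|c1N] := eqVneq c (-1).
  exists 0, (-1), 1, 0; split; first by lra.
  have s0 : s = 0 by apply/eqP; rewrite -sqrf_eq0; apply/eqP; rewrite c1N in cs; lra.
  by rewrite Aeq c1N s0; apply: matrix3P; rewrite !mxE /=; field.
have cp : 0 < 1 + c.
  have s2 := sqr_ge0 s.
  have : 0 <= 1 + c by nra.
  by rewrite le_eqVlt => /orP[/eqP h|//]; move/eqP: c1N; lra.
have sd : (1 + c) * (1 + c) - (- s) * s = 2 * (1 + c) by nra.
exists (1 + c), (- s), s, (1 + c); split; first by rewrite sd; lra.
rewrite /spin sd Aeq.
have s2 : s ^+ 2 = 1 - c ^+ 2 by lra.
have c0 : 1 + c != 0 by rewrite gt_eqF.
by apply: matrix3P; rewrite !mxE /= ?mulNr -?expr2 ?sqrrN ?s2; field.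
Qed.

(** Let (x, y, z) be the image of the time vector. Up to scale, g = [[x + y, 0], [z, 1]] is a
    Cholesky factor of its symmetric matrix, so [spin] of g sends the time vector to (x, y, z).
    Undoing it leaves an element that fixes the time vector. *)
Lemma SO1_spin A : SO1 A -> 0 < A o0 o0 ->
  exists a b c d, 0 < a * d - b * c /\ A = spin a b c d.
Proof.
move=> S A0; have [h _ _] := SO1_col S.
set x := A o0 o0 in A0 h; set y := A o1 o0 in h; set z := A o2 o0 in h.
have xy : 0 < x + y by have := sqr_ge0 z; nra.
have D : (x + y) * 1 - 0 * z != 0 by rewrite mulr1 mul0r subr0 gt_eqF.
have SV : SO1 (spin 1 (- 0) (- z) (x + y)).
  by apply: spin_SO1; rewrite mul1r oppr0 mul0r subr0 gt_eqF.
have E i : (spin 1 (- 0) (- z) (x + y) *m A) i o0 = (i == o0)%:R.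
  have xy0 : x + y != 0 by rewrite gt_eqF.
  have x1 : x - y = (1 + z ^+ 2) / (x + y) by apply: (mulIf xy0); rewrite divfK //; nra.
  rewrite mulmx3E -/x -/y -/z.
  have [xE yE] : x = ((x + y) + (1 + z ^+ 2) / (x + y)) / 2 /\
                 y = ((x + y) - (1 + z ^+ 2) / (x + y)) / 2 by split; lra.
  move: xE yE xy0; move: {D SV h x1 xy} (x + y) => w -> -> w0.
  by move: i; apply: ord3P; rewrite !mxE /= oppr0; field.
have [|||a [b [c [d [D' Aeq]]]]] := SO1_fix_spin (SO1_mul SV S); rewrite ?E //.
have : A = spin (x + y) 0 z 1 *m spin a b c d.
  rewrite -Aeq mulmxA.
  by rewrite spinV // mul1mx.
rewrite spinM => ->; do 4!eexists; split; last reflexivity.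
by rewrite (_ : _ - _ = (x + y) * (a * d - b * c)) ?mulr_gt0 //; ring.
Qed.
End Spin.

(** * The identity component of the Lorentz group *)

Section Component.
Context {R : realType}.
Implicit Types (a b c d t : R) (A B : 'M[R]_3).

Lemma SO1_0_quadratic_path (A B C : 'M[R]_3) :
  (forall s : R, SO1 (A + s *: B + s ^+ 2 *: C)) -> SO1_0 A ->
  forall t : R, SO1_0 (A + t *: B + t ^+ 2 *: C).
Proof.
move=> S GA t; apply: (connected_component_trans GA).
pose f (s : R) : 'M[R]_3 := A + s *: B + s ^+ 2 *: C.
have fc : continuous f.
  move=> s; rewrite /f; apply: cvgD; first apply: cvgD.
  - exact: cvg_cst.
  - by apply: cvgZr_tmp; exact: cvg_id.
  - by apply: cvgZr_tmp; exact: exprn_continuous.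
apply: (@connected_component_max _ _ (f @` setT)).
- by exists (0 : R) => //; rewrite /f expr0n !scale0r !addr0.
- by move=> _ [s _ <-]; exact: S.
- apply: connected_continuous_connected; last exact: continuous_subspaceT.
  by apply/connected_intervalP => x y _ _ z _.
- by exists t.
Qed.

Lemma SO1_0_spin12 t A : SO1_0 A -> SO1_0 (spin 1 t 0 1 *m A).
Proof.
move=> GA; have SA := connected_component_sub GA.
(* [N] is the derivative at 0 of s -> [spin 1 s 0 1]; since N^3 = 0, the exponential series of s N
   stops at degree 2. *)
pose N : 'M[R]_3 := mx3 0 0 1 0 0 1 1 (-1) 0.
have E s : spin 1 s 0 1 *m A = A + s *: (N *m A) + s ^+ 2 *: (2^-1 *: (N *m N *m A)).
  rewrite -[X in X + _ + _]mul1mx !scalemxAl -!mulmxDl; congr (_ *m _).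
  by apply: matrix3P; rewrite !(mulmx3E, mxE) /=; field.
rewrite E; apply: SO1_0_quadratic_path => // s; rewrite -E.
by apply: SO1_mul => //; apply: spin_SO1; rewrite mulr1 mulr0 subr0 oner_neq0.
Qed.

Lemma SO1_0_spin21 t A : SO1_0 A -> SO1_0 (spin 1 0 t 1 *m A).
Proof.
move=> GA; have SA := connected_component_sub GA.
pose N : 'M[R]_3 := mx3 0 0 1 0 0 (-1) 1 1 0.
have E s : spin 1 0 s 1 *m A = A + s *: (N *m A) + s ^+ 2 *: (2^-1 *: (N *m N *m A)).
  rewrite -[X in X + _ + _]mul1mx !scalemxAl -!mulmxDl; congr (_ *m _).
  by apply: matrix3P; rewrite !(mulmx3E, mxE) /=; field.
rewrite E; apply: SO1_0_quadratic_path => // s; rewrite -E.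
by apply: SO1_mul => //; apply: spin_SO1; rewrite mulr1 mul0r subr0 oner_neq0.
Qed.

(** Shears generate SL_2(R), here as an induction over row operations: three shears reach any matrix
    with c != 0, and one more reduces c = 0 to that case. It serves for connectedness and for the
    invariance of Lebesgue measure. *)
Lemma SL2_ind (P : R -> R -> R -> R -> Prop) :
  P 1 0 0 1 ->
  (forall t a b c d, a * d - b * c = 1 -> P a b c d -> P (a + t * c) (b + t * d) c d) ->
  (forall t a b c d, a * d - b * c = 1 -> P a b c d -> P a b (c + t * a) (d + t * b)) ->
  forall a b c d, a * d - b * c = 1 -> P a b c d.
Proof.
move=> P1 P12 P21.
have Pe a b c d a' b' c' d' : P a b c d -> a = a' -> b = b' -> c = c' -> d = d' ->
    P a' b' c' d' by move=> ? <- <- <- <-.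
have Pc a b c d : c != 0 -> a * d - b * c = 1 -> P a b c d.
  move=> c0 D.
  have H1 : P 1 ((d - 1) / c) 0 1.
    by apply: Pe (P12 ((d - 1) / c) 1 0 0 1 _ P1) _ _ _ _; ring.
  have H2 : P 1 ((d - 1) / c) c d.
    by apply: Pe (P21 c _ _ _ _ _ H1) _ _ _ _; field.
  have b1 : (d - 1) / c + (a - 1) / c * d = b.
    by rewrite (_ : b = (a * d - 1) / c); [field|rewrite -D; field].
  by apply: Pe (P12 ((a - 1) / c) _ _ _ _ _ H2) _ _ _ _; first [exact: b1|by field].
move=> a b c d D; have [c0|/Pc] := eqVneq c 0; last exact.
have a0 : a != 0.
  by apply/eqP => a0; move: D; rewrite a0 c0 mulr0 mul0r subrr => /esym/eqP; rewrite oner_eq0.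
have H : P a b (c + a) (d + b) by apply: Pc; [rewrite c0 add0r|rewrite -D; ring].
by apply: Pe (P21 (-1) _ _ _ _ _ H) _ _ _ _; first [by ring|by rewrite -D; ring].
Qed.

Lemma spin_SO1_0 a b c d : 0 < a * d - b * c -> SO1_0 (spin a b c d).
Proof.
move=> D; have D0 : a * d - b * c != 0 by rewrite gt_eqF.
pose r := (Num.sqrt (a * d - b * c))^-1.
have r2 : r ^+ 2 * (a * d - b * c) = 1 by rewrite exprVn sqr_sqrtr ?mulVf // ltW.
have r0 : r != 0 by rewrite invr_eq0 sqrtr_eq0 -ltNge.
rewrite -(spinZ _ _ _ _ r0).
have : r * a * (r * d) - r * b * (r * c) = 1 by rewrite -r2; ring.
move: (r * a) (r * b) (r * c) (r * d) => {D D0 r r2 r0}a' b' c' d'.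
apply: (@SL2_ind (fun a b c d => SO1_0 (spin a b c d))).
- rewrite spin1; apply: connected_component_refl; rewrite -spin1; apply: spin_SO1.
  by rewrite mulr1 mulr0 subr0 oner_neq0.
- move=> t {}a {}b {}c {}d _ /(SO1_0_spin12 t); rewrite spinM.
  by congr SO1_0; apply: spin_cast; ring.
- move=> t {}a {}b {}c {}d _ /(SO1_0_spin21 t); rewrite spinM.
  by congr SO1_0; apply: spin_cast; ring.
Qed.

(** On [SO1] the corner entry has square at least 1, so it keeps its sign on a connected set
    containing the identity. Conversely, [SO1_spin] and the shears connect such a matrix to the
    identity. *)
Lemma SO1_0E A : SO1_0 A <-> SO1 A /\ 0 < A o0 o0.
Proof.
split; last first.
  by move=> [SA A0]; have [a [b [c [d [D ->]]]]] := SO1_spin SA A0; exact: spin_SO1_0.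
move=> [C [C1 CS CC] CA]; split; first exact: CS.
rewrite ltNge; apply/negP => A0.
have : connected ((fun M : 'M[R]_3 => M o0 o0) @` C).
  apply: connected_continuous_connected CC _.
  by apply: continuous_subspaceT; exact: coord_continuous.
move/connected_intervalP => /(_ (A o0 o0) 1).
have H1 : ((fun M : 'M[R]_3 => M o0 o0) @` C) 1 by exists 1%:M => //; rewrite mxE.
have HA : ((fun M : 'M[R]_3 => M o0 o0) @` C) (A o0 o0) by exists A.
move=> /(_ HA H1 0); rewrite A0 ler01 => /(_ isT)[M /CS SM M0].
have [h _ _] := SO1_row SM; rewrite M0 in h.
by have := sqr_ge0 (M o0 o1); have := sqr_ge0 (M o0 o2); lra.
Qed.

Lemma SO1_0_spinP A : SO1_0 A ->
  exists a b c d, a * d - b * c = 1 /\ A = spin a b c d.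
Proof.
move=> /SO1_0E[SA A0]; have [a [b [c [d [D ->]]]]] := SO1_spin SA A0.
pose r := (Num.sqrt (a * d - b * c))^-1.
have r2 : r ^+ 2 * (a * d - b * c) = 1.
  by rewrite exprVn sqr_sqrtr ?mulVf ?gt_eqF // ltW.
have r0 : r != 0 by rewrite invr_eq0 sqrtr_eq0 -ltNge.
exists (r * a), (r * b), (r * c), (r * d); rewrite (spinZ _ _ _ _ r0); split => //.
by rewrite -r2; ring.
Qed.

Lemma SO1_0_1 : SO1_0 (1%:M : 'M[R]_3).
Proof. by rewrite -spin1; apply: spin_SO1_0; rewrite mulr1 mulr0 subr0. Qed.

Lemma SO1_0M A B : SO1_0 A -> SO1_0 B -> SO1_0 (A *m B).
Proof.
move=> /SO1_0_spinP[a [b [c [d [D ->]]]]] /SO1_0_spinP[a' [b' [c' [d' [D' ->]]]]].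
rewrite spinM; apply: spin_SO1_0.
rewrite (_ : _ - _ = (a * d - b * c) * (a' * d' - b' * c')); last by ring.
by rewrite D D' mulr1.
Qed.

Lemma SO1_0V A : SO1_0 A -> A \in unitmx /\ SO1_0 (invmx A).
Proof.
move=> /SO1_0_spinP[a [b [c [d [D ->]]]]].
have D0 : a * d - b * c != 0 by rewrite D oner_neq0.
have H := spinVl D0; have [_ U] := mulmx1_unit H.
split=> //; have -> : invmx (spin a b c d) = spin d (- b) (- c) a.
  by rewrite -[LHS]mul1mx -H mulmxK.
by apply: spin_SO1_0; rewrite mulrNN mulrC D.
Qed.

End Component.

(** * Haar measure *)

Section BorelMatrices.
Context {R : realType}.

Definition rat_box m n (q : 'M[rat]_(m, n)) (e : rat) : set 'M[R]_(m, n) :=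
  [set y | forall i j, `|ratr (q i j) - y i j| < ratr e].

Lemma open_rat_box m n (O : set 'M[R]_(m, n)) : open O ->
  O = \bigcup_(qe in [set qe : 'M[rat]_(m, n) * rat | rat_box qe.1 qe.2 `<=` O])
        rat_box qe.1 qe.2.
Proof.
move=> oO; apply/seteqP; split; last by move=> x [qe qeO /qeO].
move=> x Ox.
have /nbhs_ballP[e /= e0 eO] : nbhs x O by exact: open_nbhs_nbhs.
have [r /[!in_itv]/= /andP[r0 re]] := rat_in_itvoo (divr_gt0 e0 (ltr0n R 2)).
have /choice[q qP] (ij : 'I_m * 'I_n) : exists q : rat, `|ratr q - x ij.1 ij.2| < ratr r.
  have [q /[!in_itv]/= /andP[q1 q2]] :=
    @rat_in_itvoo R (x ij.1 ij.2 - ratr r) (x ij.1 ij.2 + ratr r) ltac:(lra).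
  by exists q; rewrite ltr_norml; lra.
exists (\matrix_(i, j) q (i, j), r) => /=; last first.
  by move=> i j; rewrite mxE; exact: (qP (i, j)).
move=> y Hy; apply: eO; split => // i j.
have := Hy i j; rewrite mxE => H1; have /= H2 := qP (i, j).
rewrite /ball /= (_ : x i j - y i j = (ratr (q (i, j)) - y i j) - (ratr (q (i, j)) - x i j)); last by ring.
by apply: le_lt_trans (ler_normB _ _) _; lra.
Qed.

(** An open set is a countable union of rational boxes, and the preimage of a box is a finite
    intersection of conditions on single entries. *)
Lemma measurable_fun_borelM d (T : measurableType d) n (f : T -> borelM R n) :
  (forall i j, measurable_fun setT (fun x => (f x : 'M[R]_n.+1) i j)) ->
  measurable_fun setT f.
Proof.
move=> mf; apply: (@measurability _ _ _ _ setT f (@open 'M[R]_n.+1)) => //.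
move=> _ [V oV <-]; rewrite setTI (open_rat_box oV) preimage_bigcup.
rewrite bigcup_mkcond; apply: countable_bigcupT_measurable.
  exact: countableP.
move=> [q e] /=; case: ifPn => // _.
have -> : f @^-1` rat_box q e =
    \bigcap_(ij in [set: 'I_n.+1 * 'I_n.+1])
      [set x | `|ratr (q ij.1 ij.2) - (f x : 'M[R]_n.+1) ij.1 ij.2| < ratr e].
  apply/seteqP; split=> x /= H; first by move=> [i j] _; exact: H.
  by move=> i j; exact: (H (i, j)).
apply: fin_bigcap_measurable; first exact: finite_finset.
move=> [i j] _ /=.
have mg : measurable_fun setT (fun x => `|ratr (q i j) - (f x : 'M[R]_n.+1) i j|).
  apply: measurableT_comp => //.
  exact: measurable_funB.
rewrite -[X in measurable X]setTI.
have := mg measurableT `]-oo, ratr e[%classic (measurable_itv _).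
by congr (measurable (_ `&` _)); apply/seteqP; split => x /=; rewrite in_itv.
Qed.

Lemma open_borelM n (O : set 'M[R]_n.+1) : open O -> measurable (O : set (borelM R n)).
Proof. by move=> oO; apply: sub_sigma_algebra. Qed.

Lemma closed_borelM n (C : set 'M[R]_n.+1) : closed C -> measurable (C : set (borelM R n)).
Proof.
move=> cC; rewrite -(setCK C); apply: measurableC; apply: open_borelM.
exact: closed_openC.
Qed.

End BorelMatrices.

Lemma measurable_preimageT d1 d2 (T1 : measurableType d1) (T2 : measurableType d2)
  (f : T1 -> T2) (A : set T2) : measurable_fun setT f -> measurable A ->
  measurable (f @^-1` A).
Proof. by move=> mf mA; rewrite -[X in measurable X]setTI; exact: mf. Qed.

(** * Lebesgue measure under the action of SL_2(R) *)

Section PlaneLebesgue.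
Context {R : realType}.
Local Notation mR := (measurableTypeR R).
Local Notation plane := (mR * mR)%type.
Implicit Types (t a b c d : R).

Lemma lebesgue_measure_shift t (A : set mR) : measurable A ->
  lebesgue_measure ((fun x : mR => (x + t)%R : mR) @^-1` A) = lebesgue_measure A.
Proof.
move=> mA.
have mf : measurable_fun setT (fun x : mR => (x + t)%R : mR).
  exact: measurable_funD.
rewrite -[LHS]/(pushforward lebesgue_measure (fun x : mR => (x + t)%R : mR) A).
apply/esym/lebesgue_measure_unique => //.
move=> _ [[a b] _ <-].
transitivity (lebesgue_measure (`](a - t)%R, (b - t)%R]%classic : set mR)); last first.
  congr lebesgue_measure.
  by apply/seteqP; split=> x /=; rewrite !in_itv /= ltrBlDr lerBrDr.
rewrite !lebesgue_measure_itv /= !lte_fin ltrD2r.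
by case: ifP => // _; rewrite -!EFinB; congr (_%:E); ring.
Qed.

Definition leb2 : set plane -> \bar R := (lebesgue_measure \x lebesgue_measure)%E.
HB.instance Definition _ := Measure.on leb2.

Let leb2_sigma_finite : sigma_finite setT leb2.
Proof.
have /sigma_finiteP[F [TF ndF Foo]] := sigma_finiteT (@lebesgue_measure R).
exists (fun n => F n `*` F n).
  apply/esym/seteqP; split=> // -[x y] _.
  have [/= n _ Fnx] : (\bigcup_i F i) x by rewrite -TF.
  have [/= k _ Fky] : (\bigcup_i F i) y by rewrite -TF.
  exists (maxn n k) => //; split.
  - by move: x Fnx; exact/subsetPset/ndF/leq_maxl.
  - by move: y Fky; exact/subsetPset/ndF/leq_maxr.
move=> n; have [mF Fn] := Foo n; split; first exact: measurableX.
by rewrite /leb2 product_measure1E // lte_mul_pinfty // ge0_fin_numE.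
Qed.

HB.instance Definition _ := Measure_isSigmaFinite.Build _ _ _ leb2 leb2_sigma_finite.

Definition act2 a b c d (p : plane) : plane :=
  ((a * p.1 + b * p.2)%R, (c * p.1 + d * p.2)%R).

Lemma act2M a b c d a' b' c' d' (p : plane) :
  act2 a b c d (act2 a' b' c' d' p) =
  act2 (a * a' + b * c') (a * b' + b * d') (c * a' + d * c') (c * b' + d * d') p.
Proof.
case: p => x y; rewrite /act2 /=.
have E (u v x' y' : R) : u * (a' * x' + b' * y') + v * (c' * x' + d' * y') =
  (u * a' + v * c') * x' + (u * b' + v * d') * y' by ring.
by congr (_, _); exact: E.
Qed.

Lemma measurable_act2 a b c d : measurable_fun setT (act2 a b c d).
Proof.
by apply: measurable_fun_pair; apply: measurable_funD; apply: measurable_funM.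
Qed.

(** Tonelli: both orders of integration agree. Horizontal shears translate the sections at fixed
    second coordinate, vertical shears those at fixed first coordinate. *)
Lemma leb2E (A : set plane) : measurable A ->
  leb2 A = (lebesgue_measure \x^ lebesgue_measure)%E A.
Proof.
move=> mA; apply: product_measure_unique => // X Y mX mY.
exact: product_measure2E.
Qed.

Lemma leb2_act12 t (A : set plane) : measurable A ->
  leb2 (act2 1 t 0 1 @^-1` A) = leb2 A.
Proof.
move=> mA; rewrite !leb2E //; last exact: measurable_preimageT (measurable_act2 _ _ _ _) mA.
apply: eq_integral => y _ /=.
rewrite -[RHS](lebesgue_measure_shift (t * y)); last exact: measurable_ysection.
have E x : act2 1 t 0 1 (x, y) = (x + t * y, y) by rewrite /act2 /= !mul1r mul0r add0r.
congr lebesgue_measure; apply/seteqP; split => x /ysectionP H; apply/ysectionP; move: H.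
- by rewrite /preimage /mkset E.
- by rewrite /preimage /mkset E.
Qed.

Lemma leb2_act21 t (A : set plane) : measurable A ->
  leb2 (act2 1 0 t 1 @^-1` A) = leb2 A.
Proof.
move=> mA.
apply: eq_integral => x _ /=.
rewrite -[RHS](lebesgue_measure_shift (t * x)); last exact: measurable_xsection.
have E y : act2 1 0 t 1 (x, y) = (x, y + t * x).
  by rewrite /act2 /= !mul1r mul0r addr0 [_ + y]addrC.
congr lebesgue_measure; apply/seteqP; split => y /xsectionP H; apply/xsectionP; move: H.
- by rewrite /preimage /mkset E.
- by rewrite /preimage /mkset E.
Qed.

Lemma leb2_act a b c d (A : set plane) : a * d - b * c = 1 -> measurable A ->
  leb2 (act2 a b c d @^-1` A) = leb2 A.
Proof.
move=> D; move: A; apply: (@SL2_ind _ (fun a b c d =>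
  forall A : set plane, measurable A -> leb2 (act2 a b c d @^-1` A) = leb2 A)) D.
- move=> A _; congr leb2; apply/seteqP.
  by split=> -[x y]; rewrite /= /act2 /= !mul1r !mul0r addr0 add0r.
- move=> t a' b' c' d' _ IH A mA; rewrite -(leb2_act12 t mA) -[RHS]IH; last first.
    exact: measurable_preimageT (measurable_act2 _ _ _ _) mA.
  congr leb2; apply/seteqP.
  by split=> p; rewrite /preimage /mkset act2M !mul1r ?mul0r ?add0r ?addr0 // ![_ + t * _]addrC.
- move=> t a' b' c' d' _ IH A mA; rewrite -(leb2_act21 t mA) -[RHS]IH; last first.
    exact: measurable_preimageT (measurable_act2 _ _ _ _) mA.
  congr leb2; apply/seteqP.
  by split=> p; rewrite /preimage /mkset act2M !mul1r ?mul0r ?add0r ?addr0 // ![_ + t * _]addrC.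
Qed.

(* Elements of plane * plane are 2x2 matrices given by their two columns. *)
Definition leb4 : set (plane * plane) -> \bar R := (leb2 \x leb2)%E.
HB.instance Definition _ := Measure.on leb4.

Definition act4 a b c d (p : plane * plane) : plane * plane :=
  (act2 a b c d p.1, act2 a b c d p.2).

(** Left multiplication acts on each column by [act2]. The invariance of [leb2] is used on the
    second column with the first one fixed, then on the first column as a change of variables in the
    outer integral. *)
Lemma leb4_act a b c d (A : set (plane * plane)) : a * d - b * c = 1 ->
  measurable A -> leb4 (act4 a b c d @^-1` A) = leb4 A.
Proof.
move=> D mA.
have mL := measurable_act2 a b c d.
transitivity (\int[leb2]_u ((leb2 \o xsection A) \o act2 a b c d) u)%E.
  apply: eq_integral => u _ /=.
  rewrite -[RHS](leb2_act D); last exact: measurable_xsection.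
  by congr leb2; apply/seteqP; split=> v /xsectionP H; apply/xsectionP.
have mf := measurable_fun_xsection leb2 mA.
have := @ge0_integral_pushforward _ _ _ _ _ _ mL leb2 setT (leb2 \o xsection A) measurableT mf.
rewrite (preimage_setT (act2 a b c d)) => H.
have f0 : {in setT, forall y, (0 <= (leb2 \o xsection A) y)%E} by move=> y _; exact: measure_ge0.
apply: etrans (esym (H f0)) _.
apply: eq_measure_integral => B mB _.
exact: leb2_act.
Qed.

End PlaneLebesgue.

Lemma measurable_invr (R : realType) : measurable_fun setT (fun x : R => x^-1).
Proof.
(* [powR] inverts the nonnegative number x^2; multiplying by x restores the sign, and at 0 both
   sides vanish by convention. *)
have -> : (fun x : R => x^-1) = (fun x => x * (x ^+ 2) `^ (-1)).
  apply/funext => x; rewrite powR_inv1 ?sqr_ge0 //.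
  have [->|x0] := eqVneq x 0; first by rewrite invr0 mul0r.
  by field.
apply: measurable_funM => //.
exact: (measurableT_comp (measurable_powR (-1)) (@exprn_measurable R setT 2)).
Qed.

(** * Haar measure as a cone measure *)

Section Haar.
Context {R : realType}.
Local Notation mR := (measurableTypeR R).
Local Notation plane := (mR * mR)%type.
Implicit Types (p : plane * plane).

Definition det4 p : R := p.1.1 * p.2.2 - p.2.1 * p.1.2.
Definition spin4 p : borelM R 2 := spin (p.1.1 : R) p.2.1 p.1.2 p.2.2.
(** The part of the cone over SL_2 up to determinant 1. [spin4] is constant along scalings, and the
    bound on the determinant truncates that direction. *)
Definition strip : set (plane * plane) := [set p | 0 < det4 p /\ det4 p <= 1].

Lemma measurable_entries :
  [/\ measurable_fun setT (fun p => p.1.1 : R), measurable_fun setT (fun p => p.1.2 : R),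
      measurable_fun setT (fun p => p.2.1 : R) & measurable_fun setT (fun p => p.2.2 : R)].
Proof.
split.
- exact: (measurableT_comp measurable_fst measurable_fst).
- exact: (measurableT_comp measurable_snd measurable_fst).
- exact: (measurableT_comp measurable_fst measurable_snd).
- exact: (measurableT_comp measurable_snd measurable_snd).
Qed.

Lemma measurable_det4 : measurable_fun setT det4.
Proof.
have [m1 m2 m3 m4] := measurable_entries.
by apply: measurable_funB; apply: measurable_funM.
Qed.

Lemma measurable_spin4 : measurable_fun setT spin4.
Proof.
have [m1 m2 m3 m4] := measurable_entries.
have md : measurable_fun setT (fun p => (det4 p)^-1).
  by apply: measurableT_comp; [exact: measurable_invr|exact: measurable_det4].
apply: measurable_fun_borelM; apply: ord3P; apply: ord3P;
  rewrite /spin4 /spin; under eq_fun => p do rewrite !mxE /=;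
  apply: measurable_funM => //;
  repeat first [exact: m1 | exact: m2 | exact: m3 | exact: m4
    | apply: measurable_funM | apply: measurable_funB | apply: measurable_funD
    | apply: measurable_funX | exact: measurable_cst].
Qed.

Lemma measurable_strip : measurable strip.
Proof.
have -> : strip = det4 @^-1` `]0, 1].
  by apply/seteqP; split=> p /=; rewrite in_itv /=; [move=> [-> ->]|move/andP].
exact: measurable_preimageT measurable_det4 _.
Qed.

Lemma act4_strip a b c d (p : plane * plane) : a * d - b * c = 1 ->
  det4 (act4 a b c d p) = det4 p /\ spin4 (act4 a b c d p) = spin a b c d *m spin4 p.
Proof.
move=> D; split.
  rewrite /det4 /act4 /act2 /= -[RHS]mul1r -D.
  have E (x y z t : R) : (a * x + b * y) * (c * z + d * t) - (a * z + b * t) * (c * x + d * y) =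
    (a * d - b * c) * (x * t - z * y) by ring.
  exact: E.
by rewrite spinM.
Qed.

End Haar.

Lemma mx_norm_coord (R : realType) m n (x : 'M[R]_(m, n)) i j : `|x i j| <= `|x|.
Proof.
rewrite [leRHS]mx_normE -[leLHS]nngE num_le.
by apply: (@le_bigmax _ _ _ _ (fun ij => `|x ij.1 ij.2|%:nng) (i, j)).
Qed.

Lemma measurable_ler_set d (T : measurableType d) (R : realType) (f g : T -> R) :
  measurable_fun setT f -> measurable_fun setT g -> measurable [set x | f x <= g x].
Proof.
move=> mf mg; exact: (measurable_preimageT (A := [set true]) (measurable_fun_ler mf mg)).
Qed.

Section HaarMeasure.
Context {R : realType}.
Local Notation mR := (measurableTypeR R).
Local Notation plane := (mR * mR)%type.
Implicit Types (p : plane * plane).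

Lemma spin_measure : exists mu : {measure set (borelM R 2) -> \bar R},
  forall A, mu A = leb4 (spin4 @^-1` A `&` strip).
Proof.
pose m : {measure set (plane * plane) -> \bar R} := mrestr (@leb4 R) (@measurable_strip R).
unshelve refine (ex_intro _ (pushforward m (@spin4 R) : {measure set (borelM R 2) -> \bar R}) _).
  exact: measurable_spin4.
by [].
Qed.

Lemma leb2_box (A B : set mR) : measurable A -> measurable B ->
  leb2 (A `*` B) = (lebesgue_measure A * lebesgue_measure B)%E.
Proof. exact: product_measure1E. Qed.

Lemma leb4_box (A B C D : set mR) : measurable A -> measurable B -> measurable C -> measurable D ->
  leb4 ((A `*` B) `*` (C `*` D)) =
  (lebesgue_measure A * lebesgue_measure B * (lebesgue_measure C * lebesgue_measure D))%E.
Proof.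
move=> mA mB mC mD.
rewrite -!leb2_box //.
by apply: product_measure1E; exact: measurableX.
Qed.

Lemma leb4_cube_lty (r : R) :
  (leb4 ((`[(- r)%R, r] `*` `[(- r)%R, r]) `*` (`[(- r)%R, r] `*` `[(- r)%R, r]))%classic < +oo)%E.
Proof.
have H : lebesgue_measure (`[(- r)%R, r]%classic : set mR) \is a fin_num.
  by rewrite lebesgue_measure_itv /=; case: ifP.
rewrite leb4_box; [|exact: measurable_itv..].
by rewrite -(fineK H) -!EFinM ltry.
Qed.

Lemma strip_SO1_0 p : strip p -> SO1_0 (spin4 p : 'M[R]_3).
Proof. by move=> [D _]; exact: spin_SO1_0. Qed.

Lemma spin_measure_haar (mu : {measure set (borelM R 2) -> \bar R}) :
  (forall A, mu A = leb4 (spin4 @^-1` A `&` strip)) -> is_haar (@SO1_0 R 2) mu.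
Proof.
move=> muE; split.
- rewrite muE (_ : _ `&` _ = set0) ?measure0 //.
  by apply/seteqP; split=> p // [/= + /strip_SO1_0].
- rewrite muE (_ : _ `&` _ = strip); last first.
    by apply/seteqP; split=> p; [case|move=> H; split => //; exact: strip_SO1_0].
  (* With a, d in [I] and b, c in [J] the determinant lies between 9/16 - 1/4 and 1, so this box of
     positive measure is inside the strip. *)
  pose I : set mR := `](3/4)%R, 1%R[%classic; pose J : set mR := `]0%R, (1/2)%R[%classic.
  have [mI mJ] : measurable I /\ measurable J by split; exact: measurable_itv.
  have [lI lJ] : lebesgue_measure I = (1/4)%:E /\ lebesgue_measure J = (1/2)%:E.
    split; rewrite lebesgue_measure_itv /= lte_fin.
      by rewrite (_ : 3/4 < 1) -?EFinB; [congr (_%:E)|]; lra.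
    by rewrite (_ : 0 < 1/2) -?EFinB; [congr (_%:E)|]; lra.
  apply: (@lt_le_trans _ _ (leb4 ((I `*` J) `*` (J `*` I)))).
    rewrite leb4_box // lI lJ -!EFinM lte_fin; lra.
  apply: le_measure; rewrite ?inE; [|exact: measurable_strip|].
    by do !apply: measurableX.
  move=> [[a c] [b d]] /= [[]]; rewrite /I /J /= !in_itv /= => /andP[a1 a2] /andP[c1 c2].
  move=> [/andP[b1 b2] /andP[d1 d2]]; rewrite /strip /det4 /=; split; nra.
- move=> K cK.
  have mK : measurable (K : set (borelM R 2)).
    by apply: closed_borelM; apply: compact_closed cK; exact: norm_hausdorff.
  have [M [_ KM]] := compact_bounded cK.
  have {}KM : forall x, K x -> `|x o0 o0| <= M + 1.
    move=> x Kx; have := KM (M + 1) ltac:(lra) x Kx; apply: le_trans.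
    exact: mx_norm_coord.
  rewrite muE.
  (* The corner entry of [spin] is (a^2 + b^2 + c^2 + d^2) / (2 det); as det <= 1, its bound M + 1
     bounds the four entries by [r]. *)
  pose r := 2 * (M + 1) + 1.
  apply: le_lt_trans (leb4_cube_lty r).
  apply: le_measure; rewrite ?inE.
  + apply: measurableI; last exact: measurable_strip.
    exact: measurable_preimageT measurable_spin4 mK.
  + by do !apply: measurableX; exact: measurable_itv.
  + move=> [[a c] [b d]] /= [/KM + [D0 D1]]; rewrite /det4 /= in D0 D1.
    rewrite /spin4 /spin !mxE /= => H.
    have H2 : (a ^+ 2 + b ^+ 2 + c ^+ 2 + d ^+ 2) / 2 <= (M + 1) * (a * d - b * c).
      by move: (le_trans (ler_norm _) H); rewrite mulrC ler_pdivrMr.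
    have M0 : 0 <= M + 1 by apply: le_trans H.
    have H3 : a ^+ 2 + b ^+ 2 + c ^+ 2 + d ^+ 2 <= 2 * (M + 1) by nra.
    have bnd (t : R) : t ^+ 2 <= 2 * (M + 1) -> - r <= t <= r.
      by move=> t2; rewrite -ler_norml -(ler_pXn2r (n := 2)) ?nnegrE ?real_normK ?num_real // /r; nra.
    have := sqr_ge0 a; have := sqr_ge0 b; have := sqr_ge0 c; have := sqr_ge0 d => d2 c2 b2 a2.
    by rewrite !in_itv /=; do !split; apply: bnd; lra.
- move=> g A Gg mA; rewrite !muE.
  have [a [b [c [d [D gE]]]]] := SO1_0_spinP Gg.
  have D' : d * a - (- b) * (- c) = 1 by rewrite -D; ring.
  have mB : measurable (spin4 @^-1` A `&` strip : set (plane * plane)).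
    by apply: measurableI (measurable_strip); exact: measurable_preimageT measurable_spin4 mA.
  rewrite -(leb4_act D' mB); congr leb4.
  have D0 : a * d - b * c != 0 by rewrite D oner_neq0.
  apply/seteqP; split=> p.
    move=> [[x Ax gx] sp]; have [e1 e2] := act4_strip p D'.
    rewrite /preimage /mkset; split; last by rewrite /strip /mkset e1.
    by rewrite e2 -gx gE mulmxA spinVl // mul1mx.
  move=> [Ap sp]; have [e1 e2] := act4_strip p D'.
  split; last by move: sp; rewrite /strip /mkset e1.
  by exists (spin4 (act4 d (- b) (- c) a p)) => //; rewrite e2 gE mulmxA spinV // mul1mx.
Qed.
(** A Siegel set: the columns u, v of g satisfy |u| <= 1 and |<u|v>| <= |u|^2. Right multiplication
    by the matrix [[1, 2], [0, 1]] of [par] adds 2 u to v. *)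
Definition siegel : set (plane * plane) := [set p | strip p /\
  ((p.1.1 : R) ^+ 2 + p.1.2 ^+ 2 <= 1 /\
   `|(p.1.1 : R) * p.2.1 + p.1.2 * p.2.2| <= (p.1.1 : R) ^+ 2 + p.1.2 ^+ 2)].

Lemma measurable_siegel : measurable siegel.
Proof.
have [m1 m2 m3 m4] := @measurable_entries R.
apply: measurableI; first exact: measurable_strip.
have mn : measurable_fun setT (fun p => (p.1.1 : R) ^+ 2 + p.1.2 ^+ 2).
  by apply: measurable_funD; apply: measurable_funX.
apply: measurableI.
  by apply: measurable_ler_set => //; exact: measurable_cst.
apply: measurable_ler_set => //; apply: measurableT_comp => //.
by apply: measurable_funD; apply: measurable_funM.
Qed.

Lemma leb4_siegel_lty : (leb4 siegel < +oo)%E.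
Proof.
pose I : set mR := `[(-1)%R, 1%R]%classic.
have mI : measurable I by exact: measurable_itv.
have lI : lebesgue_measure I = 2%:E.
  by rewrite lebesgue_measure_itv /= lte_fin (_ : -1 < 1) -?EFinB; [congr (_%:E)|]; lra.
have sec u : (leb2 (xsection siegel u) <= 4%:E * (\1_(I `*` I) u)%:E)%E.
  case: u => x y.
  have [xy|nxy] := pselect ((x : R) ^+ 2 + y ^+ 2 <= 1); last first.
    rewrite (_ : xsection _ _ = set0) ?measure0 ?mule_ge0 ?lee_fin //.
    by apply/seteqP; split=> // v /xsectionP [_ [/= /nxy]].
  have Ixy : (I `*` I) (x, y).
    have := sqr_ge0 (x : R); have := sqr_ge0 (y : R) => y2 x2.
    split; rewrite /I /= in_itv /= -ler_norml -(ler_pXn2r (n := 2)) ?nnegrE ?real_normK ?num_real //; lra.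
  rewrite indicE mem_set // mule1.
  set n := (x : R) ^+ 2 + y ^+ 2 in xy *.
  have [n0|n0] := eqVneq n 0.
    have [x0 y0] : x = 0 /\ y = 0.
      have := sqr_ge0 (x : R); have := sqr_ge0 (y : R) => y2 x2.
      by split; apply/eqP; rewrite -sqrf_eq0; apply/eqP; rewrite /n in n0; lra.
    rewrite (_ : xsection _ _ = set0) ?measure0 ?lee_fin //.
    apply/seteqP; split=> // v /xsectionP [[]]; rewrite /det4 /= x0 y0 mul0r mulr0 subr0.
    by rewrite ltxx.
  have np : 0 < n by rewrite lt_neqAle eq_sym n0 addr_ge0 ?sqr_ge0.
  (* For fixed u != 0 the map v -> (<u|v> / |u|^2, det(u, v)) has determinant 1 and sends the
     section into [-1, 1] x ]0, 1]; its area is thus at most 4, whatever the length of u. *)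
  have D : (x / n) * x - (y / n) * (- y) = 1 by rewrite /n in n0 *; field.
  have mB : measurable (I `*` I) by exact: measurableX.
  apply: (@le_trans _ _ (leb2 (I `*` I))); last by rewrite leb2_box // lI -EFinM lee_fin; lra.
  rewrite -(leb2_act D mB).
  apply: le_measure; rewrite ?inE.
  - by apply: measurable_xsection; exact: measurable_siegel.
  - exact: measurable_preimageT (measurable_act2 _ _ _ _) mB.
  move=> [v w] /xsectionP [[]]; rewrite /det4 /= => d0 d1 [_ h].
  rewrite -/n in h.
  split; rewrite /I /= in_itv /=.
  - rewrite -ler_norml (_ : _ + _ = (x * v + y * w) / n); last first.
      have E (x' y' v' w' n' : R) : x' / n' * v' + y' / n' * w' = (x' * v' + y' * w') / n' by ring.
      exact: E.
    by rewrite normrM normfV (gtr0_norm np) ler_pdivrMr // mul1r.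
  - rewrite (_ : _ + _ = x * w - v * y); first by rewrite d1 andbT; lra.
    have E (x' y' v' w' : R) : - y' * v' + x' * w' = x' * w' - v' * y' by ring.
    exact: E.
apply: (@le_lt_trans _ _ (\int[leb2]_u (4%:E * (\1_(I `*` I) u)%:E))%E).
  apply: ge0_le_integral => //.
  - exact: measurable_fun_xsection measurable_siegel.
  - by apply: measurable_funeM; apply/measurable_EFinP; apply: measurable_indic; exact: measurableX.
  - by move=> u _; exact: sec.
rewrite ge0_integralZl //; last first.
  by apply/measurable_EFinP; apply: measurable_indic; exact: measurableX.
rewrite integral_indic //; last exact: measurableX.
by rewrite setIT -[X in (_ * X)%E]/(leb2 (I `*` I)) leb2_box // lI -!EFinM ltry.
Qed.
End HaarMeasure.

(** * The triangle group *)

Section IntegerMatrices.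
Context {R : realType}.
Implicit Types (A B : 'M[R]_3).

Definition intmx A := forall i j, A i j \is a Num.int.

Lemma intmxM A B : intmx A -> intmx B -> intmx (A *m B).
Proof. by move=> iA iB i j; rewrite mulmx3E !rpredD // rpredM. Qed.

Lemma intmxP A : intmx A -> exists M : 'M[int]_3, A = map_mx intr M.
Proof.
move=> iA.
have /choice[f Hf] (ij : 'I_3 * 'I_3) : exists m : int, A ij.1 ij.2 = m%:~R by apply/intrP.
exists (\matrix_(i, j) f (i, j)); apply/matrixP => i j.
by rewrite !mxE -(Hf (i, j)).
Qed.

Lemma finite_intmx (K : R) : finite_set [set A | intmx A /\ forall i j, `|A i j| <= K].
Proof.
have [N KN] : exists N : nat, K <= N%:R.
  by exists (Num.truncn K).+1; apply: ltW; exact: truncnS_gt.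
pose g (f : {ffun 'I_3 * 'I_3 -> 'I_(N + N).+1}) : 'M[R]_3 :=
  \matrix_(i, j) ((f (i, j) : nat)%:R - N%:R).
apply: (@sub_finite_set _ _ (g @` setT)); last by apply: finite_image; exact: finite_finset.
move=> A [iA AK].
have /choice[f Hf] (ij : 'I_3 * 'I_3) : exists k : 'I_(N + N).+1, A ij.1 ij.2 = (k : nat)%:R - N%:R.
  have /intrP[m Am] := iA ij.1 ij.2.
  have := AK ij.1 ij.2; rewrite Am => /le_trans/(_ KN).
  rewrite ler_norml -[N%:R]/((N%:Z)%:~R : R) -rmorphN /= !ler_int => /andP[m1 m2].
  have : 0 <= m + N%:Z by rewrite -lerBlDr sub0r.
  case E : (m + N%:Z) => [k|//] _.
  have kN : (k < (N + N).+1)%N by rewrite ltnS -lez_nat -E PoszD lerD2r.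
  exists (Ordinal kN) => /=.
  have : (m + N%:Z)%:~R = (k%:Z)%:~R :> R by rewrite E.
  by rewrite intrD rmorphN => /(canRL (addrK _)).
exists (finfun f) => //; apply/matrixP => i j.
by rewrite mxE ffunE -(Hf (i, j)).
Qed.

End IntegerMatrices.

Section Triangle.
Context {R : realType}.
Implicit Types (A B : 'M[R]_3).

Definition rot4 : 'M[R]_3 := mx3 1 0 0 0 0 1 0 (-1) 0.
Definition par : 'M[R]_3 := mx3 3 (-2) 2 2 (-1) 2 2 (-2) 1.
Definition parV : 'M[R]_3 := mx3 3 (-2) (-2) 2 (-1) (-2) (-2) 2 1.

Lemma rot4E : rot4 = spin 1 1 (-1) 1.
Proof. by apply: matrix3P; rewrite !mxE /=; field. Qed.

Lemma parE : par = spin 1 2 0 1.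
Proof. by apply: matrix3P; rewrite !mxE /=; field. Qed.

Lemma parVE : parV = spin 1 (-2) 0 1.
Proof. by apply: matrix3P; rewrite !mxE /=; field. Qed.

(** Words in the generators, built by left multiplication; the cube of [rot4] is its inverse, so
    only [par] comes with a separate inverse. *)
Inductive triangle : set 'M[R]_3 :=
| triangle1 : triangle 1%:M
| triangle_rot A : triangle A -> triangle (rot4 *m A)
| triangle_par A : triangle A -> triangle (par *m A)
| triangle_parV A : triangle A -> triangle (parV *m A).

Lemma triangleM A B : triangle A -> triangle B -> triangle (A *m B).
Proof.
move=> + tB; elim=> [|{}A _ IH|{}A _ IH|{}A _ IH]; rewrite ?mul1mx // -mulmxA.
- exact: triangle_rot.
- exact: triangle_par.
- exact: triangle_parV.
Qed.

Lemma tri_rot : triangle rot4.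
Proof. by rewrite -[rot4]mulmx1; apply: triangle_rot; exact: triangle1. Qed.

Lemma tri_par : triangle par.
Proof. by rewrite -[par]mulmx1; apply: triangle_par; exact: triangle1. Qed.

Lemma tri_parV : triangle parV.
Proof. by rewrite -[parV]mulmx1; apply: triangle_parV; exact: triangle1. Qed.

Lemma rot4_4 : rot4 *m (rot4 *m (rot4 *m rot4)) = 1%:M.
Proof. by apply: matrix3P; rewrite !(mulmx3E, mxE) /=; ring. Qed.

Lemma par_parV : par *m parV = 1%:M.
Proof. by apply: matrix3P; rewrite !(mulmx3E, mxE) /=; ring. Qed.

Lemma triangle_inv A : triangle A -> exists2 B, triangle B & A *m B = 1%:M.
Proof.
elim=> [|{}A _ [B tB AB]|{}A _ [B tB AB]|{}A _ [B tB AB]].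
- by exists 1%:M; [exact: triangle1|rewrite mulmx1].
- exists (B *m (rot4 *m (rot4 *m rot4))).
    by apply: triangleM => //; do 2!apply: triangle_rot; exact: tri_rot.
  by rewrite -mulmxA (mulmxA A) AB mul1mx rot4_4.
- exists (B *m parV); first by apply: triangleM => //; exact: tri_parV.
  by rewrite -mulmxA (mulmxA A) AB mul1mx par_parV.
- exists (B *m par); first by apply: triangleM => //; exact: tri_par.
  by rewrite -mulmxA (mulmxA A) AB mul1mx (mulmx1C par_parV).
Qed.

Lemma triangle_unit A : triangle A -> A \in unitmx /\ triangle (invmx A).
Proof.
move=> /triangle_inv[B tB AB]; have [uA _] := mulmx1_unit AB; split => //.
by rewrite -[invmx A]mulmx1 -AB mulKmx.
Qed.

Lemma triangle_SO1_0 : triangle `<=` @SO1_0 R 2.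
Proof.
move=> A; elim=> [|{}A _ IH|{}A _ IH|{}A _ IH].
- exact: SO1_0_1.
- by apply: SO1_0M => //; rewrite rot4E; apply: spin_SO1_0; lra.
- by apply: SO1_0M => //; rewrite parE; apply: spin_SO1_0; lra.
- by apply: SO1_0M => //; rewrite parVE; apply: spin_SO1_0; lra.
Qed.

Lemma triangle_int A : triangle A -> intmx A.
Proof.
elim=> [|{}A _ IH|{}A _ IH|{}A _ IH].
- by move=> i j; rewrite mxE natr_int.
- apply: intmxM => //; apply: ord3P; apply: ord3P; rewrite mxE /=;
    by rewrite ?rpredN ?rpred0 ?rpred1 ?natr_int.
- apply: intmxM => //; apply: ord3P; apply: ord3P; rewrite mxE /=;
    by rewrite ?rpredN ?rpred0 ?rpred1 ?natr_int.
- apply: intmxM => //; apply: ord3P; apply: ord3P; rewrite mxE /=;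
    by rewrite ?rpredN ?rpred0 ?rpred1 ?natr_int.
Qed.

(** The elements are integer matrices, so the open unit ball around one of them contains no
    other. *)
Lemma triangle_discrete : is_discrete_subgroup (@SO1_0 R 2) triangle.
Proof.
split; first split.
- exact: triangle_SO1_0.
- exact: triangle1.
- exact: triangleM.
- exact: triangle_unit.
move=> A tA; split; first exact: mem_set.
exists (ball A 1); first exact: nbhsx_ballx.
apply/seteqP; split=> [B [AB tB]|_ ->]; last by split => //; exact: ballxx.
apply/matrixP => i j; apply/eqP; rewrite -subr_eq0; apply/negPn/negP => ne.
have : B i j - A i j \is a Num.int by rewrite rpredB //; exact: triangle_int.
move=> /norm_intr_ge1/(_ ne); apply/negP; rewrite -ltNge distrC.
by case: AB => _ /(_ i j).
Qed.

End Triangle.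

(** * Lexicographic minimization and the fundamental domain *)

Section LexOrder.
Context {T : Type} {R : realType}.
Implicit Types (fs : seq (T -> R)).

Fixpoint lexle fs (x y : T) : bool :=
  if fs is f :: fs' then (f x < f y) || ((f x == f y) && lexle fs' x y) else true.

Lemma lexle_total fs x y : lexle fs x y || lexle fs y x.
Proof. by elim: fs => //= f fs IH; case: (ltgtP (f x) (f y)) => //=; rewrite IH. Qed.

Lemma lexle_trans fs y x z : lexle fs x y -> lexle fs y z -> lexle fs x z.
Proof.
elim: fs => //= f fs IH /orP[xy|/andP[/eqP xy l1]] /orP[yz|/andP[/eqP yz l2]].
- by rewrite (lt_trans xy yz).
- by rewrite -yz xy.
- by rewrite xy yz.
- by rewrite xy yz eqxx IH // orbT.
Qed.

Lemma lexle_anti fs x y : lexle fs x y -> lexle fs y x -> map (@^~ x) fs = map (@^~ y) fs.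
Proof.
elim: fs => //= f fs IH; case: (ltgtP (f x) (f y)) => //= -> l1 l2.
by rewrite IH.
Qed.

Lemma lexle_seq_min (U : eqType) (h : U -> T) fs x0 (s : seq U) :
  exists2 m, m \in x0 :: s & forall y, y \in x0 :: s -> lexle fs (h m) (h y).
Proof.
have rfl x : lexle fs x x by have := lexle_total fs x x; rewrite orbb.
elim: s => [|a s [m ms mP]].
  by exists x0; rewrite ?mem_head // => y /[!inE] /eqP ->.
have [ma|am] := orP (lexle_total fs (h m) (h a)).
  exists m; first by move: ms; rewrite !inE => /orP[->|->] //; rewrite !orbT.
  move=> y; rewrite !inE => /or3P[/eqP ->|/eqP ->|ys] //.
  - by apply: mP; rewrite mem_head.
  - by apply: mP; rewrite inE ys orbT.
exists a; first by rewrite !inE eqxx orbT.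
move=> y; rewrite !inE => /or3P[/eqP ->|/eqP ->|ys] //.
- by apply: lexle_trans am _; apply: mP; rewrite mem_head.
- by apply: lexle_trans am _; apply: mP; rewrite inE ys orbT.
Qed.

End LexOrder.

Lemma measurable_lexle d (T : measurableType d) (U : Type) (R : realType)
    (fs : seq (U -> R)) (x y : T -> U) :
  (forall k, (k < size fs)%N -> measurable_fun setT (nth (fun=> 0) fs k \o x)) ->
  (forall k, (k < size fs)%N -> measurable_fun setT (nth (fun=> 0) fs k \o y)) ->
  measurable_fun setT (fun t => lexle fs (x t) (y t)).
Proof.
elim: fs => [|f fs IH] mx my /=; first exact: measurable_cst.
have mfx := mx 0 isT; have mfy := my 0 isT.
apply: measurable_or; first exact: measurable_fun_ltr.
apply: measurable_and; first exact: measurable_fun_eqr.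
by apply: IH => k ks; [exact: (mx k.+1)|exact: (my k.+1)].
Qed.

Section FundamentalDomain.
Context {R : realType}.
Implicit Types (A B x y g h : 'M[R]_3).

(** The time coordinate of the image of (3, 1, 0), equal to (2 |u|^2 + |v|^2) / det g for the
    columns u, v of g. This vector is timelike, which makes the height proper, and off the axis of
    [rot4], so that comparing x with [x *m rot4] is informative. *)
Definition height x : R := 3 * x o0 o0 + x o0 o1.

Definition keys : seq ('M[R]_3 -> R) :=
  height :: [seq (fun x : 'M[R]_3 => x ij.1 ij.2) | ij <- enum {: 'I_3 * 'I_3}].

Definition fundamental : set (borelM R 2) :=
  [set x | SO1_0 (x : 'M[R]_3) /\ forall h, triangle h -> lexle keys x (x *m h : 'M[R]_3)].

Lemma lexle_keys_anti x y : lexle keys x y -> lexle keys y x -> x = y.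
Proof.
move=> xy yx; have [_ E] := lexle_anti xy yx.
apply/matrixP => i j; move: E; rewrite -!map_comp => /eq_in_map E.
by apply: (E (i, j)); rewrite -enumT mem_enum.
Qed.

Lemma lexle_keys_height x y : lexle keys x y -> height x <= height y.
Proof. by move=> /= /orP[/ltW //|/andP[/eqP -> _]]. Qed.

Lemma height_lt_lexle x y : height x < height y -> lexle keys x y.
Proof. by move=> /= ->. Qed.

(** Properness of the height: |y01| <= y00 gives y00 <= height, and every entry of a Lorentz matrix
    has square at most 1 + y00^2. *)
Lemma SO1_0_entry y i j : SO1_0 y -> `|y i j| <= 1 + height y.
Proof.
move=> /SO1_0E[S y0]; have [r0 r1 r2] := SO1_row S; have [c0 _ _] := SO1_col S.
have n2 k l := sqr_ge0 (y k l).
have y01 : `|y o0 o1| <= y o0 o0.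
  rewrite -(ler_pXn2r (n := 2)) ?nnegrE ?real_normK ?num_real //; last exact: ltW.
  by have := n2 o0 o2; lra.
have h0 : y o0 o0 <= height y.
  by rewrite /height; move: y01; rewrite ler_norml => /andP[]; lra.
rewrite -(ler_pXn2r (n := 2)) ?nnegrE ?real_normK ?num_real //; last by lra.
suff : y i j ^+ 2 <= 1 + y o0 o0 ^+ 2 by nra.
have := (n2 o0 o1, n2 o0 o2, n2 o1 o0, n2 o2 o0); have := (n2 o1 o1, n2 o1 o2, n2 o2 o1, n2 o2 o2).
move=> [[[n11 n12] n21] n22] [[[n01 n02] n10] n20].
by move: i j; apply: ord3P; apply: ord3P; lra.
Qed.

Lemma finite_low_orbit g (C : R) : SO1_0 g ->
  finite_set [set h | triangle h /\ height (g *m h) <= C].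
Proof.
move=> Gg; have [ug _] := SO1_0V Gg.
apply: sub_finite_set (finite_intmx (3 * `|invmx g| * (1 + `|C|))) => h [th hC].
split; first exact: triangle_int.
have -> : h = invmx g *m (g *m h) by rewrite mulKmx.
have Gy : SO1_0 (g *m h) by apply: SO1_0M => //; exact: triangle_SO1_0.
move: (g *m h) Gy hC => y Gy yC i j; rewrite mulmx3E.
have E k : `|invmx g i k * y k j| <= `|invmx g| * (1 + `|C|).
  rewrite normrM ler_pM //; first exact: mx_norm_coord.
  apply: le_trans (SO1_0_entry _ _ Gy) _; rewrite lerD2l.
  by apply: le_trans yC _; exact: ler_norm.
apply: le_trans (ler_normD _ _) _.
have := ler_normD (invmx g i o0 * y o0 j) (invmx g i o1 * y o1 j).
by have := (E o0, E o1, E o2); move=> [[E0 E1] E2]; lra.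
Qed.

(** Only finitely many points of the coset are at most as high as g; the least of them for [lexle]
    is least in the whole coset, and antisymmetry makes it unique. *)
Lemma fundamental_orbit g : SO1_0 g ->
  exists! x, fundamental x /\ exists2 h, triangle h & x = g *m h.
Proof.
move=> Gg.
have /finite_seqP[s sE] := finite_low_orbit (height g) Gg.
have [m ms mP] := lexle_seq_min (fun h => g *m h) keys 1%:M s.
have s1 : 1%:M \in s.
  suff : [set` s] 1%:M by []. 
  by rewrite -sE; split; [exact: triangle1|rewrite mulmx1].
have memE h : h \in 1%:M :: s -> triangle h /\ height (g *m h) <= height g.
  rewrite inE => /orP[/eqP ->|hs]; last by have : [set` s] h by []; rewrite -sE.
  by split; [exact: triangle1|rewrite mulmx1].
have [tm hm] := memE m ms.
have mmin h : triangle h -> lexle keys (g *m m) (g *m h).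
  move=> th; have [hh|hh] := leP (height (g *m h)) (height g).
    apply: mP; rewrite inE; apply/orP; right.
    by have : [set` s] h by rewrite -sE.
  by apply: height_lt_lexle; exact: le_lt_trans hh.
exists (g *m m); split.
  split; last by exists m.
  split; first by apply: SO1_0M => //; exact: triangle_SO1_0.
  by move=> h th; rewrite -mulmxA; apply: mmin; exact: triangleM.
move=> y [[Gy yP] [h th yE]]; apply: lexle_keys_anti; first by rewrite yE; exact: mmin.
have [hV thV hhV] := triangle_inv th.
have := yP (hV *m m) (triangleM thV tm).
by rewrite yE mulmxA -(mulmxA g) hhV mulmx1.
Qed.

(** Minimality is tested against four elements: [par] and [parV] give |C| <= A + B, and [rot4] with
    its inverse, its cube, gives |C| <= - B. Here A + B = |u|^2 / det and C = <u|v> / det for the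
    columns u, v of p. *)
Lemma fundamental_siegel (p : (measurableTypeR R * measurableTypeR R) *
    (measurableTypeR R * measurableTypeR R)) :
  strip p -> fundamental (spin4 p) -> siegel p.
Proof.
move=> sp [Gy yP]; split=> //.
move: sp Gy yP; set y : 'M[R]_3 := spin4 p => -[D0 D1] Gy yP.
have yA : y o0 o0 + y o0 o1 = ((p.1.1 : R) ^+ 2 + p.1.2 ^+ 2) / det4 p.
  by rewrite /y /spin4 /spin !mxE /= -/(det4 p); field; rewrite gt_eqF.
have yC : y o0 o2 = ((p.1.1 : R) * p.2.1 + p.1.2 * p.2.2) / det4 p.
  by rewrite /y /spin4 /spin !mxE /= -/(det4 p) mulrC.
have yP' h : triangle h -> height y <= height (y *m h).
  by move=> /yP/lexle_keys_height.
have t1 := yP' _ tri_rot.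
have t3 := yP' _ (triangle_rot (triangle_rot tri_rot)).
have t4 := yP' _ tri_par.
have t5 := yP' _ tri_parV.
clearbody y; rewrite /height !(mulmx3E, mxE) /= in t1 t3 t4 t5.
have /SO1_0E[S y0] := Gy; have [r0 _ _] := SO1_row S.
set n := (_ ^+ 2 + _ ^+ 2) in yA *.
set q := (_ * _ + _ * _) in yC *.
set A := y o0 o0 in t1 t3 t4 t5 y0 r0 yA; set B := y o0 o1 in t1 t3 t4 t5 y0 r0 yA.
set C := y o0 o2 in t1 t3 t4 t5 y0 r0 yC.
have C1 : `|C| <= A + B by rewrite ler_norml; apply/andP; split; lra.
have C2 : `|C| <= - B by rewrite ler_norml; apply/andP; split; lra.
have Csq : `|C| ^+ 2 = C ^+ 2 by rewrite real_normK ?num_real.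
have nC := normr_ge0 C.
(* As A^2 - B^2 = 1 + C^2 and A - B >= A + B + 2 |C|, one gets (A + B)^2 + 2 (A + B) |C| <= 1 + C^2
   <= 1 + (A + B) |C|, which excludes A + B > 1. *)
have s1 : A + B <= 1.
  rewrite leNgt; apply/negP => s1.
  have E : (A + B) * (A - B) = 1 + `|C| ^+ 2 by rewrite Csq -r0; ring.
  have E2 : A + B + 2 * `|C| <= A - B by lra.
  have E3 : (A + B) * (A + B + 2 * `|C|) <= (A + B) * (A - B) by rewrite ler_pM2l //; lra.
  have E4 : `|C| ^+ 2 <= (A + B) * `|C| by rewrite expr2 ler_wpM2r.
  nra.
have nE : n = (A + B) * det4 p by rewrite yA divfK ?gt_eqF.
have qE : q = C * det4 p by rewrite yC divfK ?gt_eqF.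
split; first by rewrite nE; nra.
by rewrite qE nE normrM (gtr0_norm D0) ler_pM2r.
Qed.

End FundamentalDomain.

(** * Measurability of the fundamental domain and finite covolume *)

Section Lattice.
Context {R : realType}.

Lemma measurable_entry i j :
  measurable_fun setT (fun x : borelM R 2 => (x : 'M[R]_3) i j).
Proof.
apply: (measurability _ (RGenOpens.measurableE R)).
move=> _ [_ [a [b ->] <-]]; rewrite setTI; apply: open_borelM.
by move/continuousP : (@coord_continuous R 3 3 i j); apply; exact: interval_open.
Qed.

Lemma measurable_SO1_0 : measurable (@SO1_0 R 2 : set (borelM R 2)).
Proof.
have me := measurable_entry.
have mM (f : borelM R 2 -> R) (c : R) : measurable_fun setT f -> measurable [set x | f x = c].
  by move=> mf; exact: measurable_preimageT mf (measurable_set1 c).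
have -> : (@SO1_0 R 2 : set (borelM R 2)) =
  (\bigcap_(ij in [set: 'I_3 * 'I_3])
     [set x : borelM R 2 | ((x : 'M[R]_3)^T *m Jmx *m (x : 'M[R]_3)) ij.1 ij.2 = Jmx ij.1 ij.2])
  `&` [set x : borelM R 2 | \det (x : 'M[R]_3) = 1]
  `&` [set x : borelM R 2 | 0 < (x : 'M[R]_3) o0 o0].
  apply/seteqP; split=> x.
    by move=> /SO1_0E[/SO1E[xJ xd] x0]; split => //; split => // -[i j] _; rewrite /= xJ.
  move=> [[xJ xd] x0]; apply/SO1_0E; split => //; apply/SO1E; split => //.
  by apply/matrixP => i j; exact: (xJ (i, j)).
apply: measurableI; first apply: measurableI.
- apply: fin_bigcap_measurable; first exact: finite_finset.
  move=> [i j] _; apply: (mM (fun x : borelM R 2 => ((x : 'M[R]_3)^T *m Jmx *m (x : 'M[R]_3)) i j)).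
  under eq_fun => x do rewrite !(mulmx3E, mxE) /=.
  by do !first [apply: measurable_funD | apply: measurable_funM | exact: me | exact: measurable_cst].
- have md : measurable_fun setT (fun x : borelM R 2 => \det (x : 'M[R]_3)).
    rewrite (_ : (fun _ => _) = fun x : borelM R 2 =>
      (x : 'M[R]_3) o0 o0 * ((x : 'M[R]_3) o1 o1 * (x : 'M[R]_3) o2 o2 - (x : 'M[R]_3) o1 o2 * (x : 'M[R]_3) o2 o1)
      - (x : 'M[R]_3) o0 o1 * ((x : 'M[R]_3) o1 o0 * (x : 'M[R]_3) o2 o2 - (x : 'M[R]_3) o1 o2 * (x : 'M[R]_3) o2 o0)
      + (x : 'M[R]_3) o0 o2 * ((x : 'M[R]_3) o1 o0 * (x : 'M[R]_3) o2 o1 - (x : 'M[R]_3) o1 o1 * (x : 'M[R]_3) o2 o0)).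
      by apply: measurable_funD; first apply: measurable_funB;
        (apply: measurable_funM => //; apply: measurable_funB; exact: measurable_funM).
    by apply/funext => x; exact: det3E.
  exact: mM md.
- have := measurable_preimageT (me o0 o0) (measurable_itv `]0, +oo[).
  by congr measurable; apply/seteqP; split=> x /=; rewrite in_itv /= andbT.
Qed.

Lemma measurable_keys (y : borelM R 2 -> 'M[R]_3) :
  (forall i j, measurable_fun setT (fun x => y x i j)) ->
  forall k, (k < size (@keys R))%N -> measurable_fun setT (nth (fun=> 0) keys k \o y).
Proof.
move=> my [_|k] /=.
  by apply: measurable_funD => //; apply: measurable_funM => //; exact: measurable_cst.
rewrite ltnS size_map => kn.
have [[i j] /= E] : exists ij, nth (fun=> 0) [seq (fun x : 'M[R]_3 => x ij.1 ij.2) |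
    ij <- enum {: 'I_3 * 'I_3}] k = (fun x : 'M[R]_3 => x ij.1 ij.2).
  by exists (nth (o0, o0) (enum {: 'I_3 * 'I_3}) k); rewrite (nth_map (o0, o0)).
by rewrite E; exact: my.
Qed.

Lemma measurable_fundamental : measurable (@fundamental R).
Proof.
(* Conditions indexed by all integer matrices, vacuous outside the group, exhibit [fundamental] as a
   countable intersection. *)
pose L (M : 'M[int]_3) : set (borelM R 2) :=
  [set x | triangle (map_mx intr M : 'M[R]_3) -> lexle keys x (x *m map_mx intr M : 'M[R]_3)].
have -> : @fundamental R = @SO1_0 R 2 `&` ~` \bigcup_M ~` L M.
  apply/seteqP; split=> x.
    move=> [Gx xP]; split => //.
    by move=> [M _]; apply; exact: xP.
  move=> [Gx nx]; split => // h th.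
  have [M hM] := intmxP (triangle_int th).
  apply: contrapT => nl; apply: nx; exists M => // LM; apply: nl.
  by rewrite hM; apply: LM; rewrite -hM.
apply: measurableI; first exact: measurable_SO1_0.
apply: measurableC; apply: countable_bigcupT_measurable; first exact: countableP.
move=> M; apply: measurableC.
have [tM|nM] := pselect (triangle (map_mx intr M : 'M[R]_3)); last first.
  rewrite (_ : L M = setT) //; apply/seteqP; split=> // x _ /=.
  by move=> /nM.
have -> : L M = [set x : borelM R 2 | lexle keys (x : 'M[R]_3) (x *m map_mx intr M : 'M[R]_3)].
  by apply/seteqP; split=> x /= H; [exact: H|move=> _].
suff ml : measurable_fun setT
    (fun x : borelM R 2 => lexle keys (x : 'M[R]_3) (x *m map_mx intr M : 'M[R]_3)).
  exact: (measurable_preimageT (A := [set true]) ml).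
apply: measurable_lexle; apply: measurable_keys; first exact: measurable_entry.
move=> i j; under eq_fun => x do rewrite mulmx3E.
have me := measurable_entry.
by do !first [apply: measurable_funD | apply: measurable_funM | exact: me | exact: measurable_cst].
Qed.

Lemma triangle_lattice : is_lattice (@SO1_0 R 2) (@triangle R).
Proof.
split; first exact: triangle_discrete.
have [mu muE] := @spin_measure R.
exists mu, (@fundamental R); split.
- exact: spin_measure_haar.
- split; [exact: measurable_fundamental|by move=> x []|exact: fundamental_orbit].
- rewrite muE; apply: le_lt_trans (@leb4_siegel_lty R); apply: le_measure; rewrite ?inE.
  + apply: measurableI; last exact: measurable_strip.
    exact: measurable_preimageT measurable_spin4 measurable_fundamental.
  + exact: measurable_siegel.
  + by move=> p [Fp sp]; exact: fundamental_siegel.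
Qed.

End Lattice.

(** * The cusp *)

Lemma ord0_3 : (ord0 : 'I_3) = o0.
Proof. exact: val_inj. Qed.

Section NonUniform.
Context {R : realType}.

(* A cusp: the lattice vector (1,1,0) is contracted by spin e 0 0 e^-1, so no
   translate by the lattice of spin e 0 0 e^-1 stays in a bounded region. *)
Lemma triangle_cusp (e : R) (h : 'M[R]_3) : 0 < e -> triangle h ->
  1 <= 2 * e ^+ 2 * (spin e 0 0 e^-1 *m h) o0 o0.
Proof.
move=> e0 th; have e0' : e != 0 by rewrite gt_eqF.
set x := spin e 0 0 e^-1.
have Gx : SO1_0 x by apply: spin_SO1_0; rewrite divff // mul0r subr0.
have Gy : SO1_0 (x *m h) by apply: SO1_0M => //; exact: triangle_SO1_0.
have [g tg hg] := triangle_inv th.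
have yg : x *m h *m g = x by rewrite -mulmxA hg mulmx1.
move: (x *m h) Gy yg => y /SO1_0E[/[dup] Sy /SO1E[yJ _] y0] yg.
have [c0 _ _] := SO1_col Sy.
have E : Jmx *m g = y^T *m Jmx *m x by rewrite -[in RHS]yg mulmxA yJ.
(* Both sides of [E] are applied to the null vector (1, 1, 0), which x multiplies by e^2, and the
   time coordinate is read off. *)
have E' : g o0 o0 + g o0 o1 = e ^+ 2 * (y o0 o0 - y o1 o0).
  have := congr2 (fun a b => a + b) (congr1 (fun M : 'M[R]_3 => M o0 o0) E) (congr1 (fun M : 'M[R]_3 => M o0 o1) E).
  rewrite !(mulmx3E, mxE) /= divff // !mul0r !subr0 invr1 => H.
  suff : - (g o0 o0 + g o0 o1) = - (e ^+ 2 * (y o0 o0 - y o1 o0)) by move/oppr_inj.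
  by apply: etrans (etrans H _); [ring|field].
have e2 : 0 < e ^+ 2 by rewrite exprn_gt0.
have y10 : `|y o1 o0| < y o0 o0.
  rewrite -(ltr_pXn2r (n := 2)) ?nnegrE ?real_normK ?num_real //; last exact: ltW.
  by have := sqr_ge0 (y o2 o0); lra.
move: y10; rewrite ltr_norml => /andP[y1 y2].
(* A positive integer is at least 1, while y00 - y10 is less than 2 y00. *)
have gi : g o0 o0 + g o0 o1 \is a Num.int by rewrite rpredD //; exact: triangle_int.
have gp : 0 < g o0 o0 + g o0 o1 by rewrite E' mulr_gt0 // subr_gt0.
have := norm_intr_ge1 gi (lt0r_neq0 gp); rewrite gtr0_norm // E' => /le_trans; apply.
have : 0 <= e ^+ 2 * (y o0 o0 + y o1 o0) by apply: mulr_ge0; [exact: ltW|lra].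
by lra.
Qed.

(** The points having a translate with corner entry below n form an increasing cover by invariant
    open sets; a finite subcover would bound the least corner entry uniformly over all cosets,
    against [triangle_cusp]. *)
Lemma triangle_nonuniform : ~ is_uniform (@SO1_0 R 2) (@triangle R).
Proof.
move=> U.
pose O (n : nat) := [set x : 'M[R]_3 | exists2 h, triangle h & (x *m h) o0 o0 < n%:R].
have HO n : [set: nat] n -> open (O n) /\
    (forall g h, SO1_0 g -> O n g -> triangle h -> O n (g *m h)).
  move=> _; split.
    rewrite (_ : O n = \bigcup_(h in @triangle R) [set x : 'M[R]_3 | (x *m h) o0 o0 < n%:R]); last first.
      by apply/seteqP; split=> x [h th hx]; exists h.
    apply: bigcup_open => h _.
    have cf : continuous (fun x : 'M[R]_3 => (x *m h) o0 o0).
      rewrite (_ : (fun _ => _) = fun y : 'M[R]_3 =>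
        y o0 o0 * h o0 o0 + y o0 o1 * h o1 o0 + y o0 o2 * h o2 o0); last first.
        by apply/funext => y; exact: mulmx3E.
      move=> y; have Fy : Filter (nbhs (y : 'M[R]_3)) by exact: nbhs_filter.
      have c (k : 'I_3) : (x : 'M[R]_3) o0 k * h k o0 @[x --> nbhs y] --> y o0 k * h k o0.
        by apply: cvgMr_tmp; exact: coord_continuous.
      exact: (cvgD (cvgD (c o0) (c o1)) (c o2)).
    apply: (@open_comp _ _ (fun x : 'M[R]_3 => (x *m h) o0 o0) [set t | t < n%:R]).
      by move=> x _; exact: cf.
    exact: open_lt.
  move=> g h _ [k tk gk] th; have [hV tV hhV] := triangle_inv th.
  exists (hV *m k); first exact: triangleM.
  by rewrite mulmxA -(mulmxA g) hhV mulmx1.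
have [|F _ FG] := U nat setT O HO.
  move=> x Gx; exists (Num.truncn (x o0 o0)).+1 => //.
  by exists 1%:M; [exact: triangle1|rewrite mulmx1; exact: truncnS_gt].
pose N := (\max_(k <- finmap.enum_fset F) k)%N.
(* Chosen so that 2 e^2 N = 2 N / (2 N + 1) < 1. *)
pose e : R := (Num.sqrt (2 * N%:R + 1))^-1.
have N1 : 0 < 2 * N%:R + 1 :> R by rewrite ltr_wpDl // mulr_ge0.
have e0 : 0 < e by rewrite invr_gt0 sqrtr_gt0.
have Gx : SO1_0 (spin e 0 0 e^-1).
  by apply: spin_SO1_0; rewrite divff ?gt_eqF // mul0r subr0.
have [n nF [h th hn]] := FG _ Gx.
have := triangle_cusp e0 th; apply/negP; rewrite -ltNge.
have nN : (n%:R : R) <= N%:R by rewrite ler_nat; apply: (leq_bigmax_seq (F := id)).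
rewrite exprVn sqr_sqrtr ?ltW // mulrAC ltr_pdivrMr // mul1r.
by move: hn; move: (_ o0 o0) => y hy; lra.
Qed.

Lemma triangle_parn n : triangle (spin 1 (2 * n%:R) 0 1 : 'M[R]_3).
Proof.
elim: n => [|n IH]; first by rewrite mulr0 spin1; exact: triangle1.
have -> : spin 1 (2 * n.+1%:R) 0 1 = par *m spin 1 (2 * n%:R) 0 1 :> 'M[R]_3.
  by rewrite parE spinM; apply: spin_cast; rewrite -?[n.+1%:R]natr1; ring.
exact: triangle_par.
Qed.

(** The quotient x2 / (x0 - x1) ignores the normalization in [hact]. It is the horizontal coordinate
    of the upper half-plane with the fixed point of [par] at infinity, and the n-th power of [par]
    translates it by 2 n. *)
Lemma hact_par_slope (u : 'cV[R]_3) (n : nat) : u o0 0 - u o1 0 != 0 ->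
  let y := hact (spin 1 (2 * n%:R) 0 1) u in
  y o2 0 / (y o0 0 - y o1 0) = u o2 0 / (u o0 0 - u o1 0) + 2 * n%:R.
Proof.
move=> ur; rewrite /hact; set y := _ *m u; set c := (enorm y)^-1.
have yr : y o0 0 - y o1 0 = u o0 0 - u o1 0 by rewrite /y !(mulmx3E, mxE) /=; field.
have c0 : c != 0.
  rewrite invr_eq0 enorm3E sqrtr_eq0 -ltNge.
  have : 0 < (y o0 0 - y o1 0) ^+ 2 by rewrite exprn_even_gt0 //= yr.
  by have := sqr_ge0 (y o0 0 + y o1 0); have := sqr_ge0 (y o2 0); nra.
have S i : (c *: y) i 0 = c * y i 0 by rewrite [LHS]mxE.
rewrite /= !S -mulrBr yr -mulf_div divff // mul1r.
by rewrite /y !(mulmx3E, mxE) /=; field.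
Qed.

Lemma triangle_nonelementary : nonelementary (@triangle R).
Proof.
move=> v [vv v0 _] fin; rewrite ord0_3 in v0.
(* This moves v off the fixed direction of [par]: when x0 = x1 the half-turn does it. *)
have [B tB Br] : exists2 B, triangle B & (B *m v) o0 0 - (B *m v) o1 0 != 0.
  have [r0|r0] := eqVneq (v o0 0 - v o1 0) 0; last first.
    by exists 1%:M; [exact: triangle1|rewrite mul1mx].
  exists (rot4 *m rot4); first by apply: triangleM; exact: tri_rot.
  rewrite gt_eqF // -mulmxA !(mulmx3E, mxE) /=.
  by lra.
set u := B *m v in Br.
pose g n := hact (spin 1 (2 * n%:R) 0 1 *m B) v.
have gE n : g n o2 0 / (g n o0 0 - g n o1 0) = u o2 0 / (u o0 0 - u o1 0) + 2 * n%:R.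
  by rewrite -hact_par_slope // /g /hact -mulmxA.
have ginj : injective g.
  move=> m n mn; have := gE m; rewrite mn gE => /addrI/mulfI H.
  by apply/eqP; rewrite -(eqr_nat R) H ?pnatr_eq0.
have := finite_preimage (in2W ginj) fin.
rewrite (_ : g @^-1` _ = setT); first exact: infinite_nat.
apply/seteqP; split=> // n _; exists (spin 1 (2 * n%:R) 0 1 *m B) => //.
by apply: triangleM => //; exact: triangle_parn.
Qed.

End NonUniform.

(** * Invariant domains and cocycles *)

Section PolynomialBounds.
Context {R : realType}.
Implicit Types (A B C D s : R).

Lemma linear_bounded_nat C D s : (forall n : nat, C * n%:R + D < s) -> C <= 0.
Proof.
move=> H; rewrite leNgt; apply/negP => C0.
have := H (Num.truncn (`|s - D| / C)).+1; set n := _.+1.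
have : `|s - D| / C < n%:R by exact: truncnS_gt.
rewrite ltr_pdivrMr // => h1 h2; have := ler_norm (s - D); nra.
Qed.

Lemma cubic_bounded_nat A B C D s :
  (forall n : nat, A * n%:R ^+ 3 + B * n%:R ^+ 2 + C * n%:R + D < s) -> A <= 0.
Proof.
move=> H; rewrite leNgt; apply/negP => A0.
(* For n >= 1 beyond K / A, the cubic term exceeds K n^2, which dominates the lower terms and s
   together. *)
set K := `|B| + `|C| + `|D| + `|s|.
have := H (Num.truncn (K / A)).+1; set n := _.+1.
have : K / A < n%:R by exact: truncnS_gt.
have n1 : 1 <= n%:R :> R by rewrite ler1n.
rewrite ltr_pdivrMr // => h1.
have nB := ler_norm (- B); have nC := ler_norm (- C); have nD := ler_norm (- D).
have ns := ler_norm s; rewrite !normrN in nB nC nD.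
have pC := normr_ge0 C; have pD := normr_ge0 D; have ps := normr_ge0 s.
move: n%:R n1 h1 => x x1 h1.
have x2 : 1 <= x ^+ 2 by rewrite exprn_ege1.
have e1 : K * x ^+ 2 <= A * x ^+ 3.
  by rewrite (_ : A * x ^+ 3 = (x * A) * x ^+ 2); [rewrite ler_pM2r ?ltW //; lra|ring].
have e2 : - `|B| * x ^+ 2 <= B * x ^+ 2 by rewrite ler_pM2r; lra.
have e3 : - `|C| * x <= C * x by rewrite ler_pM2r; lra.
have e4 : `|C| * x <= `|C| * x ^+ 2 by rewrite ler_wpM2l // expr2; nra.
have e5 : `|D| <= `|D| * x ^+ 2 by rewrite ler_peMr.
have e6 : `|s| <= `|s| * x ^+ 2 by rewrite ler_peMr.
rewrite /K in e1; lra.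
Qed.

End PolynomialBounds.

Section ParabolicOrbit.
Context {R : realType}.
Implicit Types (x t w v : 'cV[R]_3) (z : R).

(* Iterating x |-> par x + t, computed in the coordinates x0 + x1, x2, x0 - x1. *)
Definition par_orbit x t z : 'cV[R]_3 :=
  let r := x o0 0 - x o1 0 + z * (t o0 0 - t o1 0) in
  let q := x o2 0 + z * t o2 0 + 2 * z * (x o0 0 - x o1 0)
           + (t o0 0 - t o1 0) * z * (z - 1) in
  let p := x o0 0 + x o1 0 + z * (4 * x o2 0 + 4 * (x o0 0 - x o1 0) + (t o0 0 + t o1 0))
           + (2 * t o2 0 + 4 * (x o0 0 - x o1 0)) * z * (z - 1)
           + (t o0 0 - t o1 0) * (2 / 3) * z * (z - 1) * (2 * z - 1) in
  cv3 ((p + r) / 2) ((p - r) / 2) q.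

Lemma par_orbit0 x t : par_orbit x t 0 = x.
Proof. by apply: colvec3P; rewrite !mxE /=; field. Qed.

Lemma par_orbitS x t z : par *m par_orbit x t z + t = par_orbit x t (z + 1).
Proof. by apply: colvec3P; rewrite !(mulmx3E, mxE) /=; field. Qed.

(** Backward in time, equality of the image with [Om] provides a preimage in [Om], and injectivity
    of the affine map identifies it with the previous point of the orbit. *)
Lemma par_orbit_invariant (Om : set 'cV[R]_3) x t :
  (fun y => par *m y + t) @` Om = Om -> Om x ->
  forall n : nat, Om (par_orbit x t n%:R) /\ Om (par_orbit x t (- n%:R)).
Proof.
move=> OmE Ox; elim=> [|n [IH1 IH2]]; first by rewrite oppr0 par_orbit0.
split; first by rewrite -natr1 -par_orbitS -OmE; exists (par_orbit x t n%:R).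
move: IH2; rewrite -{1}OmE => -[y Oy].
rewrite (_ : - n%:R = - n.+1%:R + 1); last by rewrite -natr1 opprD subrK.
rewrite -par_orbitS => /addIr H.
have uP : par \in unitmx := (mulmx1_unit (@par_parV R)).1.
by rewrite -(mulKmx uP (par_orbit _ _ _)) -H mulKmx.
Qed.

(* The pairing of a null vector with the orbit is a cubic polynomial in z,
   unless the vector is the fixed direction, where it is affine. *)
Lemma par_invariant_domain (Om : set 'cV[R]_3) t :
  (fun y => par *m y + t) @` Om = Om -> regular_domain Om -> t o0 0 = t o1 0.
Proof.
move=> OmE [L [LJ _ [[w s] [_ [Lw _ _]]] OmL [x Omx]]].
have [ww w0 _] := LJ _ Lw; rewrite /= in ww w0.
rewrite ord0_3 in w0.
rewrite mink3E in ww.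
have bnd y : Om y -> mink w y < s by rewrite OmL => /(_ _ Lw).
have orb := par_orbit_invariant OmE Omx.
set Rw := w o0 0 - w o1 0; set Pw := w o0 0 + w o1 0.
(* For null w, so [Rw] = 0 forces w to be a multiple of (1, 1, 0). *)
have PR : Pw * Rw = w o2 0 ^+ 2 by rewrite /Pw /Rw; lra.
set k := t o0 0 - t o1 0.
suff k0 : k = 0 by apply/eqP; rewrite -subr_eq0 -/k k0.
have [Rw0|Rw0] := eqVneq Rw 0.
  have w20 : w o2 0 = 0 by apply/eqP; rewrite -sqrf_eq0 -PR Rw0 mulr0.
  have w10 : w o1 0 = w o0 0 by apply/eqP; rewrite eq_sym -subr_eq0 -/Rw Rw0.
  have E z : mink w (par_orbit x t z) = (- w o0 0 * k) * z + (- w o0 0 * (x o0 0 - x o1 0)).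
    by rewrite mink3E !mxE /= w20 w10 /k; field.
  have h1 : - w o0 0 * k <= 0.
    apply: (@linear_bounded_nat _ _ (- w o0 0 * (x o0 0 - x o1 0)) s) => n.
    by rewrite -E; apply: bnd; exact: (orb n).1.
  (* At times - n the leading coefficient, of odd degree, changes sign; bounded both ways, it
     vanishes. *)
  have h2 : - (- w o0 0 * k) <= 0.
    apply: (@linear_bounded_nat _ _ (- w o0 0 * (x o0 0 - x o1 0)) s) => n.
    have := bnd _ (orb n).2; rewrite E.
    by congr (_ < _); ring.
  apply/eqP; rewrite -(mulrI_eq0 _ (mulfI (lt0r_neq0 w0))); apply/eqP; lra.
have [B [C [D E]]] : exists B C D, forall z, mink w (par_orbit x t z) =
    (- (2 / 3) * Rw * k) * z ^+ 3 + B * z ^+ 2 + C * z + D.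
  pose r := x o0 0 - x o1 0.
  pose a1 := 4 * x o2 0 + 4 * r + (t o0 0 + t o1 0); pose a2 := 2 * t o2 0 + 4 * r.
  exists (- Rw / 2 * (a2 - 2 * k) + w o2 0 * k).
  exists (- Rw / 2 * (a1 - a2 + 2 / 3 * k) - Pw / 2 * k + w o2 0 * (t o2 0 + 2 * r - k)).
  exists (- Rw / 2 * (x o0 0 + x o1 0) - Pw / 2 * r + w o2 0 * x o2 0).
  by move=> z; rewrite mink3E !mxE /= /a1 /a2 /r /Rw /Pw /k; field.
have h1 : - (2 / 3) * Rw * k <= 0.
  by apply: (@cubic_bounded_nat _ _ B C D s) => n; rewrite -E; apply: bnd; exact: (orb n).1.
have h2 : - (- (2 / 3) * Rw * k) <= 0.
  apply: (@cubic_bounded_nat _ _ B (- C) D s) => n.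
  have := bnd _ (orb n).2; rewrite E sqrrN.
  by congr (_ < _); ring.
apply/eqP; rewrite -(mulrI_eq0 _ (mulfI Rw0)); apply/eqP; lra.
Qed.

(** Two relations suffice: the fourth power of [rot4] being 1 kills the time component of
    [tau rot4], and the square of [par *m rot4] being 1 gives one more linear equation. Together
    with [tp] they make the values on both generators coboundaries of one vector, and the cocycle
    rule extends this to all words. *)
Lemma triangle_coboundary (tau : 'M[R]_3 -> 'cV[R]_3) :
  Z1 (@triangle R) tau -> tau par o0 0 = tau par o1 0 ->
  exists v, forall A, triangle A -> tau A = A *m v - v.
Proof.
move=> Z tp.
have Z' A B : triangle A -> triangle B -> tau (A *m B) = tau A + A *m tau B by exact: Z.
have tau1 : tau 1%:M = 0.
  have := Z' _ _ (triangle1 (R := R)) (triangle1 (R := R)).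
  by rewrite !mul1mx => /eqP; rewrite -subr_eq subrr eq_sym => /eqP.
have tr := @tri_rot R; have tpar := @tri_par R; have tparV := @tri_parV R.
set u := tau rot4; set t := tau par in tp *.
have r4 : u + rot4 *m (u + rot4 *m (u + rot4 *m u)) = 0.
  by rewrite /u -!Z' ?rot4_4 //; do !apply: triangle_rot.
have u0 : u o0 0 = 0.
  by have := congr1 (fun y : 'cV[R]_3 => y o0 0) r4; rewrite !(mulmx3E, mxE) /=; lra.
have tQ : triangle (par *m rot4 : 'M[R]_3) by apply: triangleM.
have Q2 : (par *m rot4) *m (par *m rot4) = 1%:M :> 'M[R]_3.
  by apply: matrix3P; rewrite !(mulmx3E, mxE) /=; ring.
have q2 : (t + par *m u) + (par *m rot4) *m (t + par *m u) = 0.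
  by rewrite /t /u -!Z' // Q2.
have q21 := congr1 (fun y : 'cV[R]_3 => y o1 0) q2.
rewrite !(mulmx3E, mxE) /= u0 in q21.
(* The vector u determines the spatial part of v, on which [rot4] - 1 is invertible, and t2 = 2 (v0
   - v1) determines its time part. What remains is t0 = t1 = t2 + u1 - u2, by [tp] and [q21]. *)
pose v1 := - (u o1 0 + u o2 0) / 2.
pose v : 'cV[R]_3 := cv3 (t o2 0 / 2 + v1) v1 ((u o1 0 - u o2 0) / 2).
have uE : u = rot4 *m v - v.
  by apply: colvec3P; rewrite !(mulmx3E, mxE) /= /v1; lra.
have tE : t = par *m v - v.
  by apply: colvec3P; rewrite !(mulmx3E, mxE) /= /v1; lra.
have tVE : tau parV = parV *m v - v.
  have := Z' _ _ tparV tpar; rewrite (mulmx1C (@par_parV R)) tau1 -/t tE mulmxBr mulmxA.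
  rewrite (mulmx1C (@par_parV R)) mul1mx => /eqP; rewrite eq_sym addr_eq0 opprB => /eqP.
  by [].
exists v => A; elim=> [|{}A tA IH|{}A tA IH|{}A tA IH].
- by rewrite tau1 mul1mx subrr.
- by rewrite Z' // IH -/u uE mulmxBr mulmxA addrC addrA subrK.
- by rewrite Z' // IH -/t tE mulmxBr mulmxA addrC addrA subrK.
- by rewrite Z' // IH tVE mulmxBr mulmxA addrC addrA subrK.
Qed.

End ParabolicOrbit.

(** * The future cone and the zero class *)

Section FutureCone.
Context {R : realType}.
Implicit Types (A B : 'M[R]_3) (x v w : 'cV[R]_3).

(** The lightlike hyperplanes through the origin; the domain that they define is the open future
    cone. *)
Definition cone_hyperplanes : set ('cV[R]_3 * R) := [set vs | Splus vs.1 /\ vs.2 = 0].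

(** Cauchy-Schwarz: the first row (a, b, c) of A has b^2 + c^2 = a^2 - 1, so the spatial terms of
    the product are smaller in absolute value than a x. *)
Lemma SO1_0_null_future A v : SO1_0 A -> mink v v = 0 -> 0 < v o0 0 -> 0 < (A *m v) o0 0.
Proof.
move=> /SO1_0E[S A0]; have [r0 _ _] := SO1_row S.
rewrite mink3E mulmx3E => vv v0.
set a := A o0 o0 in A0 r0 *; set b := A o0 o1 in r0 *; set c := A o0 o2 in r0 *.
set x := v o0 0 in vv v0 *; set y := v o1 0 in vv *; set z := v o2 0 in vv *.
have CS : (b * y + c * z) ^+ 2 <= (b ^+ 2 + c ^+ 2) * (y ^+ 2 + z ^+ 2).
  by have := sqr_ge0 (b * z - c * y); nra.
have lt : (b * y + c * z) ^+ 2 < (a * x) ^+ 2.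
  apply: le_lt_trans CS _.
  have -> : y ^+ 2 + z ^+ 2 = x ^+ 2 by lra.
  by rewrite exprMn ltr_pM2r ?exprn_gt0 //; lra.
have ax : 0 < a * x by exact: mulr_gt0.
move: lt; rewrite -real_normK ?num_real // ltr_pXn2r ?nnegrE //; last exact: ltW.
by rewrite ltr_norml => /andP[]; lra.
Qed.

Lemma Splus_normalize v : mink v v = 0 -> 0 < v o0 0 ->
  exists2 c : R, 0 < c & Splus (c *: v).
Proof.
move=> vv v0; rewrite mink3E in vv.
have n0 : 0 < v o0 0 ^+ 2 + v o1 0 ^+ 2 + v o2 0 ^+ 2.
  have := exprn_gt0 2 v0; have := sqr_ge0 (v o1 0); have := sqr_ge0 (v o2 0); lra.
exists (enorm v)^-1; rewrite enorm3E; first by rewrite invr_gt0 sqrtr_gt0.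
set c := (_)^-1; have c0 : 0 < c by rewrite invr_gt0 sqrtr_gt0.
have c2 : c ^+ 2 * (v o0 0 ^+ 2 + v o1 0 ^+ 2 + v o2 0 ^+ 2) = 1.
  by rewrite exprVn sqr_sqrtr ?mulVf ?gt_eqF // ltW.
split.
- rewrite mink3E !mxE (_ : _ + _ = c ^+ 2 * (- (v o0 0 * v o0 0) + v o1 0 * v o1 0 + v o2 0 * v o2 0)); last by ring.
  by rewrite vv mulr0.
- by rewrite ord0_3 mxE mulr_gt0.
- by rewrite enorm3E !mxE !exprMn -!mulrDr c2 sqrtr1.
Qed.

(** Pairing v with A x is pairing A^-1 v with x; A^-1 v is again future and null, and rescaling it
    into [Splus] keeps the sign. *)
Lemma cone_stable A x : SO1_0 A -> Omega_plus cone_hyperplanes x ->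
  Omega_plus cone_hyperplanes (A *m x).
Proof.
move=> GA xO [v s] [/= [vv v0 _] ->]; rewrite ord0_3 in v0.
have [uA GB] := SO1_0V GA.
have [[mA _] _] := (SO1_0E A).1 GA; have [[mB _] _] := (SO1_0E _).1 GB.
rewrite -{1}(mulKVmx uA v) mA.
have w0 := SO1_0_null_future GB vv v0.
have ww : mink (invmx A *m v) (invmx A *m v) = 0 by rewrite mB.
have [c c0 Sc] := Splus_normalize ww w0.
have := xO (c *: (invmx A *m v), 0) (conj Sc erefl) => /=.
move: (invmx A *m v) => w; rewrite !mink3E !mxE => H.
rewrite -(pmulr_rlt0 _ c0); apply: le_lt_trans H.
by rewrite le_eqVlt; apply/orP; left; apply/eqP; ring.
Qed.

Lemma cone_closed : closed cone_hyperplanes.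
Proof.
have cc (i : 'I_3) : continuous (fun vs : 'cV[R]_3 * R => vs.1 i 0).
  move=> vs; apply: (@continuous_comp _ _ _ fst (fun v : 'cV[R]_3 => v i 0)).
    exact: cvg_fst.
  exact: coord_continuous.
have csq (i : 'I_3) : continuous (fun vs : 'cV[R]_3 * R => vs.1 i 0 ^+ 2).
  move=> vs; apply: (@continuous_comp _ _ _ (fun vs : 'cV[R]_3 * R => vs.1 i 0) (fun t : R => t ^+ 2)).
    exact: cc.
  exact: exprn_continuous.
(* A null vector of norm 1 has time coordinate of square 1/2, so the strict condition on its sign
   may be replaced by a closed one. *)
have -> : cone_hyperplanes =
    [set vs : 'cV[R]_3 * R | vs.1 o0 0 ^+ 2 = 1 / 2] `&` [set vs : 'cV[R]_3 * R | vs.1 o1 0 ^+ 2 + vs.1 o2 0 ^+ 2 = 1 / 2]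
    `&` [set vs : 'cV[R]_3 * R | 0 <= vs.1 o0 0] `&` [set vs : 'cV[R]_3 * R | vs.2 = 0].
  apply/seteqP; split=> [[v s] [/= [vv v0 vn] ->]|[v s] /= [[[h0 h1] h2] ->]].
    rewrite ord0_3 in v0; rewrite mink3E in vv.
    have : v o0 0 ^+ 2 + v o1 0 ^+ 2 + v o2 0 ^+ 2 = 1.
      have := congr1 (fun t => t ^+ 2) vn; rewrite enorm3E sqr_sqrtr ?expr1n //.
      by rewrite !addr_ge0 ?sqr_ge0.
    by move=> n1; do !split => //=; lra.
  split => //; split.
  - by rewrite mink3E /=; lra.
  - rewrite ord0_3 lt_neqAle h2 andbT eq_sym; apply/eqP => v0.
    by rewrite v0 expr0n /= in h0; lra.
  - by rewrite enorm3E -addrA h0 h1 -mulrDl divff // sqrtr1.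
have csnd : continuous (fun vs : 'cV[R]_3 * R => vs.2) by move=> vs; exact: cvg_snd.
have csum : continuous (fun vs : 'cV[R]_3 * R => vs.1 o1 0 ^+ 2 + vs.1 o2 0 ^+ 2).
  by move=> vs; exact: (cvgD (csq o1 vs) (csq o2 vs)).
apply: closedI; first apply: closedI; first apply: closedI.
- by apply: (closed_comp (f := fun vs : 'cV[R]_3 * R => vs.1 o0 0 ^+ 2) (D := [set 1 / 2])) => [vs _|];
    [exact: csq|exact: closed_eq].
- by apply: (closed_comp (f := fun vs : 'cV[R]_3 * R => vs.1 o1 0 ^+ 2 + vs.1 o2 0 ^+ 2) (D := [set 1 / 2])) => [vs _|];
    [exact: csum|exact: closed_eq].
- by apply: (closed_comp (f := fun vs : 'cV[R]_3 * R => vs.1 o0 0) (D := [set t | 0 <= t])) => [vs _|];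
    [exact: cc|exact: closed_ge].
- by apply: (closed_comp (f := fun vs : 'cV[R]_3 * R => vs.2) (D := [set 0])) => [vs _|];
    [exact: csnd|exact: closed_eq].
Qed.

Lemma cone_regular : regular_domain (Omega_plus cone_hyperplanes).
Proof.
exists cone_hyperplanes; split => //.
- by move=> vs [].
- exact: cone_closed.
- have [c1 c10 S1] : exists2 c : R, 0 < c & Splus (c *: cv3 1 1 0).
    by apply: Splus_normalize; rewrite ?mink3E !mxE /=; lra.
  have [c2 c20 S2] : exists2 c : R, 0 < c & Splus (c *: cv3 1 (-1) 0).
    by apply: Splus_normalize; rewrite ?mink3E !mxE /=; lra.
  exists (c1 *: cv3 1 1 0, 0), (c2 *: cv3 1 (-1) 0, 0); split => //.
  by case=> /(congr1 (fun v : 'cV[R]_3 => v o1 0)); rewrite !mxE /=; lra.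
- exists (cv3 1 0 0) => -[v s] [/= [_ v0 _] ->]; rewrite ord0_3 in v0.
  by rewrite mink3E !mxE /=; lra.
Qed.

End FutureCone.

(** An invariant domain forces [tau] to be a coboundary, so its class is that of 0; conversely the
    zero cocycle acts linearly and preserves the future cone. *)
Lemma triangle_Tplus (R : realType) :
  Tplus (@triangle R) = [set H1class (@triangle R) (fun _ : 'M[R]_3 => 0 : 'cV[R]_3)].
Proof.
apply/seteqP; split=> c.
  move=> [tau [Z -> [Om [rO Oinv]]]] /=.
  have tp : tau par o0 0 = tau par o1 0.
    exact: par_invariant_domain (Oinv _ (@tri_par R)) rO.
  have [v tauE] := triangle_coboundary Z tp.
  apply/seteqP; split=> tau' [Z' [w tw]]; split => //.
    exists (w + v) => A tA; have := tw A tA; rewrite tauE // subr0 => /(canRL (subrK _)) ->.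
    by rewrite mulmxDr opprD addrACA.
  exists (w - v) => A tA; have := tw A tA; rewrite tauE // subr0 => ->.
  by rewrite mulmxBr !opprB addrACA [RHS]addrACA [- w + _]addrC.
move=> ->; exists (fun=> 0); split => //.
  by move=> A B _ _; rewrite mulmx0 addr0.
exists (Omega_plus (@cone_hyperplanes R)); split; first exact: cone_regular.
move=> A tA; have GA := triangle_SO1_0 tA; have [uA GB] := SO1_0V GA.
apply/seteqP; split=> x.
  by move=> [y Oy <-]; rewrite /affine_rep addr0; exact: cone_stable.
move=> Ox; exists (invmx A *m x); first exact: cone_stable.
by rewrite /affine_rep addr0 mulKVmx.
Qed.

Theorem proposition4p22 (R : realType) :
  exists Gam : set 'M[R]_3,
    [/\ is_lattice (@SO1_0 R 2) Gam,
        ~ is_uniform (@SO1_0 R 2) Gam,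
        nonelementary Gam &
        Tplus Gam = [set H1class Gam (fun _ : 'M[R]_3 => 0 : 'cV[R]_3)]].
Proof.
exists (@triangle R); split.
- exact: triangle_lattice.
- exact: triangle_nonuniform.
- exact: triangle_nonelementary.
- exact: triangle_Tplus.
Qed.
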